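(* Let $X$ be an infinite set. (i) $\operatorname{rank}(\mathcal F_X^L:\mathcal E_X)=2^{|X|}$. (ii) If $\Omega\subseteq\mathcal F_X^L$, then $\mathcal F_X^L=\langle\mathcal E_X\cup\Omega\rangle$ if and only if $\mathcal G_X=\langle\mathcal G_X\cap\Omega\rangle$ and $\Omega$ contains a subset of the form $\{\alpha_\mu : \mu=1\text{ or }\aleph_0\leq\mu\leq|X|\}$ (indexed by cardinals $\mu$), where for each $\mu$, $\operatorname{codef}(\alpha_\mu)<\mu=\operatorname{def}(\alpha_\mu)$.
   Context: Partial Brauer monoid. Let $X$ be a set and $X'=\{x':x\in X\}$ a disjoint copy of $X$. A Brauer graph is an (undirected) graph with vertex set $X\cup X'$ in which every vertex has degree at most $1$; $\mathcal{PB}_X$ is the set of all of them. Product: let $X''=\{x'':x\in X\}$ be another disjoint copy of $X$; given $\alpha,\beta\in\mathcal{PB}_X$, let $\alpha^\vee$ be $\alpha$ with each vertex $x'$ renamed $x''$, let $\beta^\wedge$ be $\beta$ with each vertex $x\in X$ renamed $x''$, and let $\Pi(\alpha,\beta)$ be the graph on $X\cup X'\cup X''$ with all edges of $\alpha^\vee$ and $\beta^\wedge$. Then $\alpha\beta$ is the graph on $X\cup X'$ with an edge $\{x,y\}$ whenever $x,y\in X\cup X'$ are distinct and lie in the same connected component of $\Pi(\alpha,\beta)$. This makes $\mathcal{PB}_X$ a monoid with identity the graph with edge set $\{\{x,x'\}:x\in X\}$. A transversal of $\alpha$ is an edge $\{x,y'\}$ with $x,y\in X$ (possibly $x=y$).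 $\operatorname{Dom}(\alpha)$ is the set of $x\in X$ such that $x$ belongs to a transversal of $\alpha$; $\operatorname{Codom}(\alpha)$ is the set of $x\in X$ such that $x'$ belongs to a transversal; $\operatorname{def}(\alpha)=|X\setminus\operatorname{Dom}(\alpha)|$ and $\operatorname{codef}(\alpha)=|X\setminus\operatorname{Codom}(\alpha)|$. In a monoid $M$, an element $x$ is a left unit if $ax=1$ for some $a\in M$, and a (two-sided) unit if also $xb=1$ for some $b\in M$. $\mathcal G_X^L$ and $\mathcal G_X$ denote the submonoids of all left units and of all units of $\mathcal{PB}_X$. $\mathcal E_X$ denotes the subsemigroup of $\mathcal{PB}_X$ generated by all its idempotents, and $\mathcal F_X^L$ the subsemigroup generated by all idempotents together with $\mathcal G_X^L$. For a subset $U$ of a semigroup $S$, $\langle U\rangle$ is the subsemigroup generated by $U$. For $A\subseteq S$, the relative rank is $\operatorname{rank}(S:A)=\min\{|U| : U\subseteq S,\ S=\langle A\cup U\rangle\}$. *)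

(* Defs.v *)
From HB Require Import structures.
From Stdlib Require Import Relation_Operators Operators_Properties.
From mathcomp Require Import all_boot.
From mathcomp Require Import boolp classical_sets functions cardinality.

Set Implicit Arguments.
Unset Strict Implicit.
Unset Printing Implicit Defensive.

Local Open Scope group_scope.
Local Open Scope classical_set_scope.
Local Open Scope card_scope.

Import Algebra.

Definition card_lt T U (A : set T) (B : set U) := (A #<= B) && ~~ (B #<= A).
Notation "A '#<' B" := (card_lt A B) (at level 79) : card_scope.

Section Connectivity.

Definition connected (V : Type) (R : V -> V -> Prop) : V -> V -> Prop :=
  clos_refl_trans V R.

Definition image_rel (V W : Type) (f : V -> W) (R : V -> V -> Prop) (u v : W) :=
  exists p q, [/\ R p q, u = f p & v = f q].

Lemma connected_homo (V W : Type) (f : V -> W) (R : V -> V -> Prop)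
    (S : W -> W -> Prop) :
  (forall u v, R u v -> connected S (f u) (f v)) ->
  forall u v, connected R u v -> connected S (f u) (f v).
Proof.
move=> RS u v; elim=> [x y /RS //|x|x y z _ xy _ yz]; first exact: rt_refl.
exact: rt_trans xy yz.
Qed.

Lemma connected_sym (V : Type) (R : V -> V -> Prop) :
  (forall u v, R u v -> R v u) -> forall u v, connected R u v -> connected R v u.
Proof.
move=> Rs u v; elim=> [x y /Rs xy|x|x y z _ xy _ yz].
- exact: rt_step.
- exact: rt_refl.
- exact: rt_trans yz xy.
Qed.

Lemma image_rel_connected (V W : Type) (f : V -> W) (R : V -> V -> Prop) :
  injective f -> forall u v,
  connected (image_rel f R) (f u) (f v) <-> connected R u v.
Proof.
move=> fI u v; split; last first.
  by apply: connected_homo => x y Rxy; apply: rt_step; exists x, y.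
move=> c0; have := clos_rt_rtn1 _ _ _ _ c0.
move fv : (f v) => w c; elim: c v fv {c0} => [v /fI ->|y z [p [q [Rpq -> ->]]] _ IH v /fI ->].
  exact: rt_refl.
by apply: rt_trans (IH p erefl) _; exact: rt_step.
Qed.

Lemma connected_last (V : Type) (R : V -> V -> Prop) u v :
  connected R u v -> u = v \/ exists2 p, connected R u p & R p v.
Proof.
move=> c; case: (clos_rt_rtn1 _ _ _ _ c) => [|p w pw up]; first by left.
by right; exists p => //; exact: clos_rtn1_rt.
Qed.

Lemma connected_first (V : Type) (R : V -> V -> Prop) u v :
  connected R u v -> u = v \/ exists2 p, R u p & connected R p v.
Proof.
move=> c; case: (clos_rt_rt1n _ _ _ _ c) => [|p w up pw]; first by left.
by right; exists p => //; exact: clos_rt1n_rt.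
Qed.

(* Contracting the R1-paths between the vertices satisfying P. *)
Lemma connected_contract (V : Type) (P : V -> Prop) (R1 R2 : V -> V -> Prop) :
  (forall u v, R2 u v -> P u /\ P v) ->
  forall u v, P u -> P v ->
  connected (fun x y => R1 x y \/ R2 x y) u v <->
  connected (fun x y => [/\ P x, P y, x <> y & connected R1 x y] \/ R2 x y) u v.
Proof.
move=> R2P u v Pu Pv; set R' := (X in _ <-> connected X u v).
have R1R' x y : P x -> P y -> connected R1 x y -> connected R' x y.
  move=> Px Py c; have [->|xy] := pselect (x = y); first exact: rt_refl.
  by apply: rt_step; left.
split=> [c0|]; last first.
  apply: (connected_homo (f := id)) => x y [[_ _ _]|R2xy]; last first.
    by apply: rt_step; right.
  by apply: (connected_homo (f := id)) => {}x {}y xy; apply: rt_step; left.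
suff [w [Pw uw wv]] : exists w, [/\ P w, connected R' u w & connected R1 w v].
  exact: rt_trans uw (R1R' _ _ Pw Pv wv).
elim: (clos_rt_rtn1 _ _ _ _ c0) {Pv} => [|y z yz _ [w [Pw uw wy]]].
  by exists u; split=> //; exact: rt_refl.
case: yz => yz; first by exists w; split=> //; apply: rt_trans wy _; exact: rt_step.
have [Py Pz] := R2P _ _ yz.
exists z; split=> //; last exact: rt_refl.
apply: rt_trans (rt_trans _ _ _ _ _ uw (R1R' _ _ Pw Py wy)) _.
by apply: rt_step; right.
Qed.

Lemma eq_connected (V : Type) (R S : V -> V -> Prop) :
  (forall u v, R u v <-> S u v) ->
  forall u v, connected R u v <-> connected S u v.
Proof.
by move=> RS u v; split; apply: (connected_homo (f := id)) => x y /RS;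
  exact: rt_step.
Qed.

(* A component of the union of two matchings has at most two ends. *)
Lemma matchings_ends (V : Type) (R : bool -> V -> V -> Prop) :
  (forall c u v, R c u v -> R c v u) ->
  (forall c u v w, R c u v -> R c u w -> v = w) ->
  forall u v w,
  (exists c, forall z, ~ R c u z) ->
  (exists c, forall z, ~ R c v z) ->
  (exists c, forall z, ~ R c w z) ->
  u <> v -> u <> w ->
  connected (fun x y => exists c, R c x y) u v ->
  connected (fun x y => exists c, R c x y) u w -> v = w.
Proof.
move=> Rs Rd u v w [c0 u0] v0 w0 uv uw cv cw.
pose step (s t : V * bool) := R s.2 s.1 t.1 /\ t.2 = ~~ s.2.
pose s0 := (u, ~~ c0).
have step_det s t t' : step s t -> step s t' -> t = t'.
  by case: s t t' => [x a] [y b] [z d] [/= Rxy ->] [/= Rxz ->]; rewrite (Rd _ _ _ _ Rxy Rxz).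
have visit z : connected (fun x y => exists c, R c x y) u z ->
    exists c, connected step s0 (z, c).
  move=> c1; elim: (clos_rt_rtn1 _ _ _ _ c1) => [|x y [d Rxy] _ [c cx]].
    by exists (~~ c0); exact: rt_refl.
  case: (eqVneq d c) => [dc|dc].
    exists (~~ c); apply: rt_trans cx _; apply: rt_step.
    by split=> //=; rewrite -dc.
  have {dc}dc : d = ~~ c by move: dc; clear; case: d; case: c.
  have [[xE cE]|[[p a] cp [/= Rpx ac]]] := connected_last cx.
    by case: (u0 y); rewrite xE; move: Rxy; rewrite dc -cE negbK.
  exists d; suff -> : y = p.
    by rewrite dc ac negbK.
  by apply: (Rd d x) => //; rewrite dc ac negbK; exact: Rs.
have stop z c t : (exists c, forall y, ~ R c z y) -> u <> z ->
    connected step s0 (z, c) -> ~ step (z, c) t.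
  move=> [d zd] uz cz [/= Rzt _].
  have [[zE cE]|[[p a] cp [/= Rpz ac]]] := connected_last cz; first by case: uz.
  have [dc|dc] := eqVneq d c; first by case: (zd t.1); rewrite dc.
  case: (zd p); apply: Rs.
  suff -> : d = a by [].
  by move: dc; rewrite ac; clear; case: d; case: a.
have uniq_end s t t' : connected step s t -> connected step s t' ->
    (forall r, ~ step t r) -> (forall r, ~ step t' r) -> t = t'.
  move=> c1; elim: (clos_rt_rt1n _ _ _ _ c1) t' => {s t c1} [s|s r t sr _ IH] t' c1 ts ts'.
    by have [//|[r sr _]] := connected_first c1; case: (ts r).
  have [tE|[z sz c']] := connected_first c1; first by case: (ts' r); rewrite -tE.
  by apply: IH => //; rewrite (step_det _ _ _ sr sz).
have [c vc] := visit _ cv; have [d wd] := visit _ cw.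
have : (v, c) = (w, d) by apply: (uniq_end _ _ _ vc wd) => r; [exact: (stop _ _ r v0 uv vc)|exact: (stop _ _ r w0 uw wd)].
by case.
Qed.

End Connectivity.

(* The vertex set is X + X: inl x stands for x and inr x for x'.
   Loops are excluded, since a loop contributes 2 to the degree. *)
Record brauer_graph (X : Type) := BrauerGraph {
  edge :> X + X -> X + X -> Prop;
  edge_irr : forall u, ~ edge u u;
  edge_sym : forall u v, edge u v -> edge v u;
  edge_deg : forall u v w, edge u v -> edge u w -> v = w
}.

HB.instance Definition _ (X : Type) := gen_eqMixin (brauer_graph X).
HB.instance Definition _ (X : Type) := gen_choiceMixin (brauer_graph X).

Section Product.
Variable X : Type.
Implicit Types (a b c : brauer_graph X) (u v w : X + X).

Lemma brauer_ext a b : (forall u v, a u v <-> b u v) -> a = b.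
Proof.
case: a b => [a ai As ad] [b bi bs bd] /= ab.
have E : a = b by apply: funext => u; apply: funext => v; apply: propext.
by case: b / E bi bs bd {ab} => bi bs bd; congr BrauerGraph; exact: Prop_irrelevance.
Qed.

(* The vertex set of the product graph is (X + X) + X: inl v stands for the
   vertex v of X u X', and inr x for x''. *)
Definition vee u : (X + X) + X :=
  match u with inl x => inl (inl x) | inr x => inr x end.

Definition wedge u : (X + X) + X :=
  match u with inl x => inr x | inr x => inl (inr x) end.

Definition product_graph a b (p q : (X + X) + X) :=
  image_rel vee a p q \/ image_rel wedge b p q.

Definition mul_edge a b u v :=
  u <> v /\ connected (product_graph a b) (inl u) (inl v).

Lemma vee_inj : injective vee.
Proof. by case=> x [] y //= [->]. Qed.

Lemma wedge_inj : injective wedge.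
Proof. by case=> x [] y //= [->]. Qed.

Lemma product_graph_sym a b p q : product_graph a b p q -> product_graph a b q p.
Proof.
by case=> -[u [v [/edge_sym uv -> ->]]]; [left|right]; exists v, u.
Qed.

Lemma mul_edge_irr a b u : ~ mul_edge a b u u.
Proof. by case. Qed.

Lemma mul_edge_sym a b u v : mul_edge a b u v -> mul_edge a b v u.
Proof.
move=> [uv c]; split; first exact: nesym.
exact: connected_sym (@product_graph_sym a b) _ _ c.
Qed.

Lemma mul_edge_deg a b u v w : mul_edge a b u v -> mul_edge a b u w -> v = w.
Proof.
pose R (c : bool) := if c then image_rel vee a else image_rel wedge b.
have Rs (c : bool) p q : R c p q -> R c q p.
  by case: c => -[x [y [/edge_sym xy -> ->]]]; exists y, x.
have Rd (c : bool) p q r : R c p q -> R c p r -> q = r.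
  case: c => -[x [y [xy -> ->]]] [x' [z [xz xE ->]]].
    by move: xE xy => /vee_inj -> /edge_deg /(_ xz) ->.
  by move: xE xy => /wedge_inj -> /edge_deg /(_ xz) ->.
have Rend t : exists c : bool, forall z, ~ R c (inl t) z.
  by case: t => x; [exists false|exists true] => z -[[y|y] [? [_]]].
have RE p q : connected (product_graph a b) p q ->
    connected (fun x y => exists c : bool, R c x y) p q.
  by apply: (connected_homo (f := id)) => x y [] xy; apply: rt_step;
    [exists true|exists false].
move=> [uv /RE cv] [uw /RE cw].
suff [] : @inl _ X v = inl w by [].
by apply: (matchings_ends Rs Rd _ _ _ _ _ cv cw) => //; congruence.
Qed.

Definition mul_brauer a b : brauer_graph X :=
  BrauerGraph (@mul_edge_irr a b) (@mul_edge_sym a b) (@mul_edge_deg a b).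

Definition one_edge u v :=
  exists x, (u = inl x /\ v = inr x) \/ (u = inr x /\ v = inl x).

Lemma one_edge_irr u : ~ one_edge u u.
Proof. by case=> x [] [->]. Qed.

Lemma one_edge_sym u v : one_edge u v -> one_edge v u.
Proof. by case=> x [] [-> ->]; exists x; [right|left]. Qed.

Lemma one_edge_deg u v w : one_edge u v -> one_edge u w -> v = w.
Proof. by case=> x [] [-> ->] [y] [] [] // [->] ->. Qed.

Definition one_brauer : brauer_graph X :=
  BrauerGraph one_edge_irr one_edge_sym one_edge_deg.

Lemma connected_brauer a u v : connected a u v -> u <> v -> a u v.
Proof.
move=> c; suff : u = v \/ a u v by case.
elim: c => [x y|x|x y z _ xy _ yz]; [by right|by left|].
case: xy yz => [->//|xy] [<-|yz]; first by right.
by left; apply: edge_deg yz; exact: edge_sym.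
Qed.

Lemma mul1_brauer : left_id one_brauer mul_brauer.
Proof.
move=> a; apply: brauer_ext => u v; split=> [[uv c]|uv].
  apply: connected_brauer => //.
  pose f (p : (X + X) + X) : X + X :=
    match p with inl (inl x) => inl x | inr x => inl x | inl (inr x) => inr x end.
  have -> : u = f (inl u) by case: (u).
  have -> : v = f (inl v) by case: (v).
  apply: (connected_homo _ c) => p q [] [x [y [xy -> ->]]].
    by case: xy => z [] [-> ->] /=; exact: rt_refl.
  by apply: rt_step; case: x y xy => [] x [].
split=> [E|]; first by move: uv; rewrite E; exact: edge_irr.
have g t : connected (product_graph one_brauer a) (inl t) (wedge t).
  case: t => x /=; last exact: rt_refl.
  by apply: rt_step; left; exists (inl x), (inr x); split=> //; exists x; left.
apply: rt_trans (g u) _; apply: rt_trans (connected_sym (@product_graph_sym _ _) (g v)).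
by apply: rt_step; right; exists u, v.
Qed.

Lemma mulbrauer1 : right_id one_brauer mul_brauer.
Proof.
move=> a; apply: brauer_ext => u v; split=> [[uv c]|uv].
  apply: connected_brauer => //.
  pose f (p : (X + X) + X) : X + X :=
    match p with inl (inl x) => inl x | inr x => inr x | inl (inr x) => inr x end.
  have -> : u = f (inl u) by case: (u).
  have -> : v = f (inl v) by case: (v).
  apply: (connected_homo _ c) => p q [] [x [y [xy -> ->]]].
    by apply: rt_step; case: x y xy => [] x [].
  by case: xy => z [] [-> ->] /=; exact: rt_refl.
split=> [E|]; first by move: uv; rewrite E; exact: edge_irr.
have g t : connected (product_graph a one_brauer) (inl t) (vee t).
  case: t => x /=; first exact: rt_refl.
  by apply: rt_step; right; exists (inr x), (inl x); split=> //; exists x; right.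
apply: rt_trans (g u) _; apply: rt_trans (connected_sym (@product_graph_sym _ _) (g v)).
by apply: rt_step; left; exists u, v.
Qed.

Lemma product_contract (V : Type) a b c (g h : (X + X) + X -> V)
    (k k' : X + X -> (X + X) + X) :
  injective g -> injective h -> injective k ->
  (forall u, h (inl u) = g (k u)) ->
  (forall p q, g p = h q -> exists u, p = k u) ->
  forall p q,
  connected (fun x y => image_rel k (mul_brauer a b) x y \/ image_rel k' c x y)
    p q <->
  connected (fun x y => (image_rel (h \o vee) a x y \/
    image_rel (h \o wedge) b x y) \/ image_rel (g \o k') c x y) (g p) (g q).
Proof.
move=> gI hI kI hk ghk p q.
rewrite -(image_rel_connected _ gI).
pose R1 := image_rel h (product_graph a b).
pose R2 := image_rel (g \o k') c.
pose P x := exists t, x = g t.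
have R2P x y : R2 x y -> P x /\ P y.
  by move=> [s [t [_ -> ->]]]; split; [exists (k' s)|exists (k' t)].
have R1E x y : image_rel (h \o vee) a x y \/ image_rel (h \o wedge) b x y <-> R1 x y.
  split=> [[]|] [s [t [st -> ->]]].
  - by exists (vee s), (vee t); split=> //; left; exists s, t.
  - by exists (wedge s), (wedge t); split=> //; right; exists s, t.
  by case: st => -[s' [t' [st -> ->]]]; [left|right]; exists s', t'.
have Pp : P (g p) by exists p.
have Pq : P (g q) by exists q.
apply: (iff_trans (B := connected (fun x y => R1 x y \/ R2 x y) (g p) (g q))); last first.
  by apply: eq_connected => x y; have := R1E x y; rewrite /R2; tauto.
apply: iff_trans (iff_sym (connected_contract R1 R2P Pp Pq)).
apply: eq_connected => x y; split.
  case=> x' [y' [[] [s [t [st -> ->]]] -> ->]]; [left|right]; last by exists s, t.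
  have [st1 st2] := st; split.
  - by exists (k s).
  - by exists (k t).
  - by move=> /gI /kI.
  - by rewrite -!hk; apply/(image_rel_connected _ hI).
case=> [[[s xE] [t yE] xy cxy]|]; last first.
  by move=> [s [t [st -> ->]]]; exists (k' s), (k' t); split=> //; right; exists s, t.
have [x' xE'] : exists x', x = h x'.
  by have [//|[z [x' [y' [_ -> _]]] _]] := connected_first cxy; exists x'.
have [y' yE'] : exists y', y = h y'.
  by have [//|[z _ [x'' [y' [_ _ ->]]]]] := connected_last cxy; exists y'.
have [m mE] := ghk s x' (etrans (esym xE) xE').
have [n nE] := ghk t y' (etrans (esym yE) yE').
exists (k m), (k n); rewrite -mE -nE; split=> //; left.
exists m, n; split=> //; split=> [mn|]; first by apply: xy; rewrite xE yE mE nE mn.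
by apply/(image_rel_connected _ hI); rewrite !hk -mE -nE -xE -yE.
Qed.

(* Both triple products are read off the graph with layers
   inl \o inl (X), inr \o inl, inr \o inr, inl \o inr (X'). *)
Lemma mul_brauerA : associative mul_brauer.
Proof.
pose gl (p : (X + X) + X) : (X + X) + (X + X) :=
  match p with inl t => inl t | inr x => inr (inr x) end.
pose gr (p : (X + X) + X) : (X + X) + (X + X) :=
  match p with inl t => inl t | inr x => inr (inl x) end.
pose hl (p : (X + X) + X) : (X + X) + (X + X) :=
  match p with inl (inl x) => inl (inl x) | inl (inr x) => inr (inr x)
             | inr x => inr (inl x) end.
pose hr (p : (X + X) + X) : (X + X) + (X + X) :=
  match p with inl (inl x) => inr (inl x) | inl (inr x) => inl (inr x)
             | inr x => inr (inr x) end.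
have glI : injective gl by case=> [[?|?]|?] [[?|?]|?] //= [->].
have grI : injective gr by case=> [[?|?]|?] [[?|?]|?] //= [->].
have hlI : injective hl by case=> [[?|?]|?] [[?|?]|?] //= [->].
have hrI : injective hr by case=> [[?|?]|?] [[?|?]|?] //= [->].
have hlk u : hl (inl u) = gl (vee u) by case: u.
have hrk u : hr (inl u) = gr (wedge u) by case: u.
have ghl p q : gl p = hl q -> exists u, p = vee u.
  by case: p q => [[x|x]|x] [[y|y]|y] //= _; [exists (inl x)|exists (inr x)].
have ghr p q : gr p = hr q -> exists u, p = wedge u.
  by case: p q => [[x|x]|x] [[y|y]|y] //= _; [exists (inr x)|exists (inl x)].
move=> a b c; apply: brauer_ext => u v; apply: and_iff_compat_l.
have := product_contract a b c wedge glI hlI vee_inj hlk ghl (inl u) (inl v).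
have := product_contract b c a vee grI hrI wedge_inj hrk ghr (inl u) (inl v).
rewrite (eq_connected (S := product_graph a (mul_brauer b c))); last first.
  by move=> p q; exact: or_comm.
move=> -> ->; apply: eq_connected => p q.
have -> : hl \o vee = gr \o vee by apply: funext => -[].
have -> : hl \o wedge = hr \o vee by apply: funext => -[].
have -> : gl \o wedge = hr \o wedge by apply: funext => -[].
by tauto.
Qed.

HB.instance Definition _ := isMonoid.Build (brauer_graph X)
  mul_brauerA mul1_brauer mulbrauer1.

End Product.

Section SemigroupNotions.
Variable S : semigroupType.

Definition subsemigroup (M : set S) : Prop :=
  forall x y, M x -> M y -> M (x * y).

Definition sgen (U : set S) : set S := smallest subsemigroup U.

Definition idempotents : set S := [set e | e * e = e].

(* relative_rank B A K states rank(B : A) = |K|, for B a subsemigroup of S. *)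
Definition relative_rank (T : Type) (B A : set S) (K : set T) : Prop :=
  (exists U : set S, [/\ U `<=` B, B = sgen (A `|` U) & U #= K]) /\
  (forall U : set S, U `<=` B -> B = sgen (A `|` U) -> K #<= U).

End SemigroupNotions.

Section MonoidNotions.
Variable M : monoidType.

Definition left_units : set M := [set x | exists a, a * x = 1].

Definition units : set M :=
  [set x | (exists a, a * x = 1) /\ (exists b, x * b = 1)].

End MonoidNotions.

Section PartialBrauerMonoid.
Variable X : Type.

Definition dom (a : brauer_graph X) : set X :=
  [set x | exists y, a (inl x) (inr y)].

Definition codom (a : brauer_graph X) : set X :=
  [set y | exists x, a (inl x) (inr y)].

(* def(a) and codef(a) are the cardinals of the following two sets. *)
Definition defect_set (a : brauer_graph X) : set X := ~` dom a.
Definition codefect_set (a : brauer_graph X) : set X := ~` codom a.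

Definition EX : set (brauer_graph X) := sgen (@idempotents (brauer_graph X)).

Definition FXL : set (brauer_graph X) :=
  sgen (@idempotents (brauer_graph X) `|` @left_units (brauer_graph X)).

Definition GX : set (brauer_graph X) := @units (brauer_graph X).

(* Cardinals mu <= |X| are represented by subsets of X, equipotent subsets
   representing the same cardinal. *)
Definition defect_index : set (set X) :=
  [set mu | mu #= [set: unit] \/ [set: nat] #<= mu].

Definition defect_family (alpha : set X -> brauer_graph X) : Prop :=
  (forall mu nu : set X, mu #= nu -> alpha mu = alpha nu) /\
  (forall mu, defect_index mu ->
     codefect_set (alpha mu) #< mu /\ defect_set (alpha mu) #= mu).

End PartialBrauerMonoid.

Arguments EX : clear implicits.
Arguments FXL : clear implicits.
Arguments GX : clear implicits.
Arguments defect_index : clear implicits.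

(* Main.v *)
Require Import Defs.
From HB Require Import structures.
From mathcomp Require Import all_boot.
From mathcomp Require Import boolp classical_sets functions cardinality.
From Stdlib Require Import Relation_Operators.
(* The imports above also define [dom] and [codom]. *)
Import Defs.

Set Implicit Arguments.
Unset Strict Implicit.
Unset Printing Implicit Defensive.

Local Open Scope classical_set_scope.
Local Open Scope card_scope.

(** Write def and codef for the cardinals of the defect and codefect sets.

    In a product ab, the middle layer of the product graph pairs off the
    transversals of a and of b that survive, and it pairs a vertex with itself
    where a transversal of a directly meets one of b.  Counting along this
    pairing yields cardinals K, L and M such that
      def(ab) = def(a) + L,        codef(ab) = codef(b) + M,
      def(b) = K + L,              codef(a) = K + M,
    where L and M count the transversals of a and of b that extend to none of
    ab ([defect_mul], [codefect_mul], [defect_common]).  The rest is arithmetic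
    with these four equations.

    An idempotent loses no transversals, so L = M = 0 and its defect and
    codefect agree; left units are the graphs of codefect 0; and the property
    codef <= def passes to products.  Hence codef <= def throughout F.
    Conversely, if def(a) = codef(a) + def(k) for a left unit k, then a = egk
    for an idempotent e and a unit g ([factor_codefect]): choose g such that gk
    has all the transversals of a, and let e reshape the hooks.  So F is the set
    of graphs with codef <= def, and the idempotents, the units and one left
    unit of each defect generate it.

    Necessity in (ii).  When codef <= def for both factors, a product is a unit
    only if both factors are ([unit_factors]); as 1 is the only unit in E, the
    units of Omega must generate all units.  Let mu be 1 or infinite, so that
    mu = x + y forces x = mu or y = mu.  Then the four equations show that a
    product with codef < mu = def has a factor with the same property
    ([defect_jump_mul]).  Left units of defect mu have it and idempotents do
    not, so some member of Omega does.

    Sufficiency in (ii).  Products of alpha_1 are left units of every finite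
    defect.  If mu is the least infinite defect not yet reached, then
    codef(alpha_mu) < mu is the defect of some generated left unit k; moving k
    by a unit g, one may assume that the defect set of gk is the codefect set
    of alpha_mu, and then alpha_mu g k is a left unit of defect mu.

    For (i), there are at most 2^|X| graphs because |X| * |X| = |X|.  The units
    include 2^|X| involutions, and by (ii) they are all products of the added
    generators, of which there are therefore 2^|X|: a set U has at most
    max(|U|, aleph_0) products.

    The cardinal arithmetic rests on two applications of the Zorn lemma: every
    nonempty family of sets has a member of least cardinality ([card_min]), and
    an infinite set is equipotent to its square ([card_setX_infinite]). *)

(** * Comparing cardinals by relations *)

(** Bijections are handled as relations, so that partial matchings read off a
    graph can be used without choosing values outside their domain. *)
Definition bij_rel (T U : Type) (A : set T) (B : set U) (R : T -> U -> Prop) :=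
  [/\ forall x y, R x y -> A x /\ B y,
      forall x, A x -> exists y, R x y,
      forall y, B y -> exists x, R x y,
      forall x y y', R x y -> R x y' -> y = y' &
      forall x x' y, R x y -> R x' y -> x = x'].

Lemma card_le_rel (T U : Type) (A : set T) (B : set U) (R : T -> U -> Prop) :
  (forall x, A x -> exists2 y, B y & R x y) ->
  (forall x x' y, A x -> A x' -> R x y -> R x' y -> x = x') -> A #<= B.
Proof.
move=> AR Ri.
have /choice[f fP] (a : A) : exists b : B, R (set_val a) (set_val b).
  have [y By Ry] := AR _ (set_valP a).
  by exists (SigSub (mem_set By)).
apply/card_leP; apply/injfunPex; exists f => // a b _ _ fab.
by apply: val_inj; apply: Ri (fP a) _; [exact: set_valP..|rewrite fab; exact: fP].
Qed.

Lemma card_eq_bij_rel (T U : Type) (A : set T) (B : set U) :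
  A #= B <-> exists R, bij_rel A B R.
Proof.
split=> [/card_eqP[f]|[R [RAB AR BR Rf Ri]]].
  exists (fun x y => exists2 a : A, set_val a = x & set_val (f a) = y); split.
  - by move=> x y [a <- <-]; split; apply: set_valP.
  - by move=> x Ax; exists (set_val (f (SigSub (mem_set Ax)))), (SigSub (mem_set Ax)).
  - move=> y By; have [a _ fa] := 'surj_f (I : [set: B] (SigSub (mem_set By))).
    by exists (set_val a), a => //; rewrite fa.
  - by move=> x y y' [a <- <-] [b /val_inj <- <-].
  - by move=> x x' y [a <- <-] [b <- /val_inj/inj <-] //; rewrite inE.
rewrite card_eq_le; apply/andP; split.
  apply: (@card_le_rel _ _ _ _ R) => [x /AR[y Ry]|x x' y _ _]; last exact: Ri.
  by exists y => //; case: (RAB _ _ Ry).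
apply: (@card_le_rel _ _ _ _ (fun y x => R x y)) => [y /BR[x Rx]|y y' x _ _]; last exact: Rf.
by exists x => //; case: (RAB _ _ Rx).
Qed.

Lemma card_le_sub (T U : Type) (A : set T) (B : set U) :
  A #<= B -> exists2 C, C `<=` B & A #= C.
Proof.
move=> /card_leP[f]; exists [set y | exists a, set_val (f a) = y].
  by move=> y [a <-]; exact: set_valP.
apply/card_eq_bij_rel.
exists (fun x y => exists2 a : A, set_val a = x & set_val (f a) = y); split.
- by move=> x y [a <- <-]; split; [exact: set_valP|exists a].
- by move=> x Ax; exists (set_val (f (SigSub (mem_set Ax)))), (SigSub (mem_set Ax)).
- by move=> y [a <-]; exists (set_val a), a.
- by move=> x y y' [a <- <-] [b /val_inj <- <-].
- by move=> x x' y [a <- <-] [b <- /val_inj/inj <-] //; rewrite inE.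
Qed.

Lemma card_le_inj (T U : Type) (A : set T) (B : set U) (f : T -> U) :
  (forall x, A x -> B (f x)) -> (forall x y, A x -> A y -> f x = f y -> x = y) ->
  A #<= B.
Proof.
move=> fAB fI; apply: (@card_le_rel _ _ _ _ (fun x y => f x = y)).
  by move=> x Ax; exists (f x) => //; exact: fAB.
by move=> x x' y Ax Ax' <- /esym; exact: fI.
Qed.

Lemma card_eq_le2 (T U : Type) (A : set T) (B : set U) :
  A #<= B -> B #<= A -> A #= B.
Proof. by move=> AB BA; rewrite card_eq_le AB BA. Qed.

Lemma card_eq_lel (T U : Type) (A : set T) (B : set U) : A #= B -> A #<= B.
Proof. by rewrite card_eq_le => /andP[]. Qed.

Lemma card_eq_ler (T U : Type) (A : set T) (B : set U) : A #= B -> B #<= A.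
Proof. by rewrite card_eq_le => /andP[]. Qed.

Lemma card_ltP (T U : Type) (A : set T) (B : set U) :
  A #< B <-> A #<= B /\ ~ (B #<= A).
Proof. by split=> [/andP[? /negP]|[? ?]] //; apply/andP; split=> //; exact/negP. Qed.

Lemma bij_rel_extend (T U : Type) (A : set T) (B : set U) (R : T -> U -> Prop) :
  bij_rel A B R -> ~` A #= ~` B ->
  exists g h, [/\ cancel g h, cancel h g & forall x, A x -> R x (g x)].
Proof.
move=> [RAB AR BR Rf Ri] /card_eq_bij_rel[S [SAB AS BS Sf Si]].
have /choice[g gP] x : exists y, R x y \/ S x y.
  have [/AR[y Rxy]|/AS[y Sxy]] := pselect (A x); first by exists y; left.
  by exists y; right.
have /choice[h hP] y : exists x, R x y \/ S x y.
  have [/BR[x Rxy]|/BS[x Sxy]] := pselect (B y); first by exists x; left.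
  by exists x; right.
exists g, h; split=> [x|y|x Ax].
- case: (gP x) (hP (g x)) => [Rx|Sx] [Rx'|Sx']; [exact: Ri Rx' Rx|..|exact: Si Sx' Sx].
    by have [_ []] := SAB _ _ Sx'; case: (RAB _ _ Rx).
  by have [_ []] := SAB _ _ Sx; case: (RAB _ _ Rx').
- case: (hP y) (gP (h y)) => [Rx|Sx] [Rx'|Sx']; [exact: Rf Rx' Rx|..|exact: Sf Sx' Sx].
    by have [[]] := SAB _ _ Sx'; case: (RAB _ _ Rx).
  by have [[]] := SAB _ _ Sx; case: (RAB _ _ Rx').
- by case: (gP x) => // Sx; have [] := SAB _ _ Sx.
Qed.

Lemma card_le_setX (T T' U U' : Type) (A : set T) (A' : set T') (B : set U)
    (B' : set U') : A #<= A' -> B #<= B' -> A `*` B #<= A' `*` B'.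
Proof.
move=> /card_le_sub[C CA /card_eq_bij_rel[R [RA AR _ Rf Ri]]].
move=> /card_le_sub[D DB /card_eq_bij_rel[S [SA AS _ Sf Si]]].
apply: (@card_le_rel _ _ _ _ (fun p q => R p.1 q.1 /\ S p.2 q.2)).
  move=> [a b] [/= /AR[c Rac] /AS[d Sbd]]; exists (c, d) => //; split=> /=.
    by apply: CA; case: (RA _ _ Rac).
  by apply: DB; case: (SA _ _ Sbd).
by move=> [a b] [a' b'] [c d] _ _ [/= /Ri Ra /Si Sb] [/Ra -> /Sb ->].
Qed.

(** * Sums of cardinals *)

Definition csum (T U : Type) (A : set T) (B : set U) : set (T + U) :=
  [set p | match p with inl x => A x | inr y => B y end].

Section Sums.
Variables (T U T' U' : Type).
Implicit Types (A : set T) (B : set U).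

Lemma csum_le A B (A' : set T') (B' : set U') :
  A #<= A' -> B #<= B' -> csum A B #<= csum A' B'.
Proof.
move=> /card_le_sub[C CA /card_eq_bij_rel[R [RA AR _ Rf Ri]]].
move=> /card_le_sub[D DB /card_eq_bij_rel[S [SA AS _ Sf Si]]].
apply: (@card_le_rel _ _ _ _ (fun p q => match p, q with
  | inl x, inl y => R x y | inr x, inr y => S x y | _, _ => False end)).
  move=> [x /AR|x /AS] [y Rxy]; [exists (inl y)|exists (inr y)] => //=.
    by apply: CA; case: (RA _ _ Rxy).
  by apply: DB; case: (SA _ _ Rxy).
by move=> [x|x] [x'|x'] [y|y] //= _ _ => [/Ri Rx /Rx ->|/Si Sx /Sx ->].
Qed.

Lemma csumC A B : csum A B #<= csum B A.
Proof.
apply: (@card_le_inj _ _ _ _ (fun p => match p with inl x => inr x | inr x => inl x end)).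
  by case.
by move=> [x|x] [y|y] //= _ _ [->].
Qed.

Lemma csum_lel A B : A #<= csum A B.
Proof. by apply: (@card_le_inj _ _ _ _ inl) => // x y _ _ []. Qed.

Lemma csum_ler A B : B #<= csum A B.
Proof. by apply: (@card_le_inj _ _ _ _ inr) => // x y _ _ []. Qed.

Lemma csum_set0 A : csum A (@set0 U) #= A.
Proof.
apply: card_eq_le2; last exact: csum_lel.
apply: (@card_le_rel _ _ _ _ (fun p x => p = inl x)); last by move=> p q x _ _ -> ->.
by case=> [x Ax|x []]; exists x.
Qed.

Lemma setU_csum (A C : set T) :
  (forall x, A x -> C x -> False) -> A `|` C #= csum A C.
Proof.
move=> AC; apply/card_eq_bij_rel.
exists (fun x p => csum A C p /\ match p with inl y => x = y | inr y => x = y end).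
split.
- by move=> x [y|y] [yP ->]; split=> //; [left|right].
- by move=> x [xA|xC]; [exists (inl x)|exists (inr x)].
- by move=> [y|y] yP; exists y.
- by move=> x [y|y] [y'|y'] [/= yP ->] [/= yP' E] //; rewrite ?E //; subst; case: (AC y').
- by move=> x x' [y|y] [/= _ ->] [/= _ ->].
Qed.

End Sums.

Lemma csum_eq (T U T' U' : Type) (A : set T) (B : set U) (A' : set T') (B' : set U') :
  A #= A' -> B #= B' -> csum A B #= csum A' B'.
Proof.
by move=> /[dup]/card_eq_lel ? /card_eq_ler ? /[dup]/card_eq_lel ? /card_eq_ler ?;
  apply: card_eq_le2; exact: csum_le.
Qed.

Lemma csumAC (T1 T2 T3 : Type) (A : set T1) (B : set T2) (C : set T3) :
  csum (csum A B) C #<= csum (csum A C) B.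
Proof.
apply: (@card_le_inj _ _ _ _ (fun p => match p with inl (inl x) => inl (inl x)
  | inl (inr x) => inr x | inr x => inl (inr x) end)).
  by case=> [[]|].
by move=> [[x|x]|x] [[y|y]|y] //= _ _ [->].
Qed.

(** * Least cardinals, and squares of infinite sets *)

(** Take a maximal family of choice functions for [F] no two of which agree
    anywhere on [F].  Some member of [F] is exhausted by their values, or another
    choice function could be added; it embeds in every other member by sending
    the value of a choice function to its value there. *)
Lemma card_min (T : Type) (F : set (set T)) : F !=set0 ->
  exists2 A, F A & forall B, F B -> A #<= B.
Proof.
move=> [A0 FA0].
pose P (S : set (set T -> T)) := (forall s A, S s -> F A -> A (s A)) /\
  (forall s s' A, S s -> S s' -> F A -> s A = s' A -> s = s').
have [|S [[S1 S2] Smax]] := @Zorn_bigcup _ P.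
  move=> C CP Ct; split=> [s A [S CS Ss]|s s' A [S CS Ss] [S' CS' Ss']].
    by have [CA _] := CP _ CS; exact: CA.
  have [SS|SS] := Ct _ _ CS CS'.
    by have [_ CI] := CP _ CS'; apply: (CI s s' A) => //; exact: SS.
  by have [_ CI] := CP _ CS; apply: (CI s s' A) => //; exact: SS.
have [[A FA fullA]|nfull] := pselect (exists2 A, F A & forall x, A x -> exists2 s, S s & s A = x).
  exists A => // B FB; apply: (@card_le_rel _ _ _ _ (fun x y => exists s, [/\ S s, s A = x & s B = y])).
    by move=> x /fullA[s Ss sx]; exists (s B); [exact: (S1 s B)|exists s].
  move=> x x' y _ _ [s [Ss <- sy]] [s' [Ss' <- sy']].
  by rewrite (S2 s s' B) // sy sy'.
exfalso.
have free A : F A -> exists2 x, A x & forall s, S s -> s A <> x.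
  move=> FA; apply: contrapT => nx; apply: nfull; exists A => // x Ax.
  apply: contrapT => ns; apply: nx; exists x => // s Ss sx.
  by apply: ns; exists s.
have [x0 _ _] := free _ FA0.
have /choice[t tP] A : exists x, F A -> A x /\ forall s, S s -> s A <> x.
  have [/free[x Ax xP]|nF] := pselect (F A); first by exists x.
  by exists x0 => /nF.
have [tA0 tn] := tP _ FA0.
apply: (Smax (S `|` [set t])).
  rewrite properEneq; split; last by left.
  by apply/eqP => SE; apply: (tn t) => //; rewrite SE; right.
split=> [s A [Ss|->] FA|s s' A]; first exact: (S1 s A).
  by have [] := tP _ FA.
move=> [Ss|->] [Ss'|->] FA; [exact: (S2 s s' A)|..|by []].
  by move=> E; have [_ /(_ _ Ss)] := tP _ FA; rewrite E.
by move=> E; have [_ /(_ _ Ss')] := tP _ FA; rewrite E.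
Qed.

(** Comparability is the case of a two-element family, once both sets live in the
    same type. *)
Lemma card_le_total (T U : Type) (A : set T) (B : set U) : A #<= B \/ B #<= A.
Proof.
have [|C FC Cmin] := @card_min _ [set csum A (@set0 U); csum (@set0 T) B].
  by exists (csum A set0); left.
have eA : csum A (@set0 U) #= A by exact: csum_set0.
have eB : csum (@set0 T) B #= B.
  apply: card_eq_le2; last exact: csum_ler.
  by apply: card_le_trans (csumC _ _) _; exact: card_eq_lel (csum_set0 _ _).
have CA := Cmin (csum A set0) (or_introl erefl).
have CB := Cmin (csum set0 B) (or_intror erefl).
rewrite (card_le_eqr eA) in CA; rewrite (card_le_eqr eB) in CB.
case: FC => CE; rewrite CE in CA CB.
  by left; rewrite -(card_le_eql eA).
by right; rewrite -(card_le_eql eB).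
Qed.

Lemma card_leT_fun (T U : Type) (B : set U) : [set: T] #<= B ->
  exists2 f : T -> U, injective f & forall x, B (f x).
Proof.
move=> /card_le_sub[C CB /card_eq_bij_rel[R [RTC TR _ _ Ri]]].
have /choice[f Rf] x : exists y, R x y by exact: TR.
exists f => [x y fxy|x]; last by apply: CB; case: (RTC _ _ (Rf x)).
by apply: Ri (Rf x) _; rewrite fxy.
Qed.

(** Two distinct points of [A] tag the two copies inside the square. *)
Lemma csum_setX (T : Type) (A : set T) :
  infinite_set A -> A `*` A #<= A -> csum A A #<= A.
Proof.
move=> /infiniteP/card_leT_fun[f fI fA]; apply: card_le_trans.
apply: (@card_le_inj _ _ _ _ (fun p => match p with inl x => (f 0%N, x)
  | inr x => (f 1%N, x) end)).
  by move=> [x|x] Ax; split=> //=; exact: fA.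
by move=> [x|x] [y|y] _ _ [] => [->|/fI|/fI|->].
Qed.

(** Partial pairings, ordered by inclusion of graphs, are maximized.  A graph [G]
    relates [x] to the pair that [x] codes, and [field G] is the set [D] of codes,
    in bijection with [D * D]. *)
Section Hessenberg.
Variable T : Type.
Implicit Types G : set (T * (T * T)).

Let field G : set T := [set x | exists p, G (x, p)].

Let pairing G := [/\ forall x p, G (x, p) -> field G p.1 /\ field G p.2,
  forall a b, field G a -> field G b -> exists x, G (x, (a, b)),
  forall x p p', G (x, p) -> G (x, p') -> p = p' &
  forall x x' p, G (x, p) -> G (x', p) -> x = x'].

Let pairing_card G : pairing G -> field G `*` field G #<= field G.
Proof.
move=> [G1 G2 G3 G4]; apply: (@card_le_rel _ _ _ _ (fun p x => G (x, p))).
  by move=> [a b] [/= /G2 Ga /Ga[x Gx]]; exists x => //; exists (a, b).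
by move=> p p' x _ _ /G3; apply.
Qed.

(** If the complement of [D] still contains a copy [B] of [D], then the pairs over
    the union of [D] and [B] that are not pairs over [D] number as many as [B],
    and can be coded by it. *)
Let pairing_extend G (B : set T) : pairing G -> infinite_set (field G) ->
  B #= field G -> (forall x, B x -> ~ field G x) ->
  exists2 H, pairing H & G `<` H.
Proof.
move=> PG infG BG BnG; have DD := pairing_card PG; have DS := csum_setX infG DD.
case: PG => G1 G2 G3 G4.
set D := field G in infG BG BnG DD DS G1 G2 *; pose E := D `|` B.
have ED : E #<= D.
  rewrite (card_le_eql (setU_csum _)); last by move=> x Dx /BnG.
  by apply: card_le_trans DS; apply: csum_le; rewrite ?card_lexx // card_eq_lel.
have /card_eq_bij_rel[R [RB BR ER Rf Ri]] : B #= (E `*` E) `\` (D `*` D).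
  apply: card_eq_le2.
    apply: (@card_le_inj _ _ _ _ (fun x => (x, x))) => [x Bx|x y _ _ [] //].
    by split=> [|[/= /(BnG _ Bx)]]; first by split; right.
  apply: card_le_trans (card_eq_ler BG).
  by apply: card_le_trans DD; apply: card_le_trans (card_le_setX ED ED); exact: card_le_setD.
pose H := G `|` [set q | R q.1 q.2].
have HE x : field H x <-> E x.
  split=> [[p [Gp|/= /RB[Bx _]]]|[[p Gp]|/BR[p Rp]]]; [by left; exists p|by right|..].
    by exists p; left.
  by exists p; right.
exists H; last first.
  rewrite properEneq; split; last by left.
  apply/eqP => GH; have /infiniteP/card_leT_fun[f _ /(_ 0%N) Df] := infG.
  have := card_eq_ler BG => /card_le_sub[C CB /card_eq_bij_rel[S [SC /(_ _ Df)[b Sb] _ _ _]]].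
  have Bb : B b by apply: CB; case: (SC _ _ Sb).
  by case: (BnG _ Bb); rewrite /D GH; apply/HE; right.
split.
- move=> x p [Gp|/= /RB[_ [[E1 E2] _]]]; last by split; apply/HE.
  by have [D1 D2] := G1 _ _ Gp; split; apply/HE; left.
- move=> a b /HE Ea /HE Eb; have [[Da Db]|nD] := pselect (D a /\ D b).
    by have [x Gx] := G2 _ _ Da Db; exists x; left.
  by have [|x Rx] := ER (a, b); [split|exists x; right].
- move=> x p p' [Gp|/= Rp] [Gp'|/= Rp']; [exact: G3 Gp Gp'|..|exact: Rf Rp Rp'].
    by case: (BnG x); [case: (RB _ _ Rp')|exists p].
  by case: (BnG x); [case: (RB _ _ Rp)|exists p'].
- move=> x x' p [Gp|/= Rp] [Gp'|/= Rp']; [exact: G4 Gp Gp'|..|exact: Ri Rp Rp'].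
    by have [_ [_]] := RB _ _ Rp'; case; exact: G1 Gp.
  by have [_ [_]] := RB _ _ Rp; case; exact: G1 Gp'.
Qed.

Let pairing_nat : infinite_set [set: T] -> exists2 G, pairing G & infinite_set (field G).
Proof.
move=> /infiniteP/card_leT_fun[f fI _].
have /card_eq_bij_rel[R [_ nR Rn Rf Ri]] := card_nat2.
pose G : set (T * (T * T)) := [set q | exists n i j, [/\ R (i, j) n, q.1 = f n & q.2 = (f i, f j)]].
have GE x : field G x <-> exists n, x = f n.
  split=> [[p [n [i [j [_ /= -> _]]]]]|[n ->]]; first by exists n.
  by have [[i j] Rn'] := Rn n I; exists (f i, f j), n, i, j.
exists G; last first.
  apply/infiniteP; apply: (@card_le_inj _ _ _ _ f) => [n _|x y _ _ /fI//].
  by apply/GE; exists n.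
split.
- by move=> x p [n [i [j [_ _ /= ->]]]]; split; apply/GE; [exists i|exists j].
- move=> a b /GE[i ->] /GE[j ->]; have [n Rn'] := nR (i, j) I.
  by exists (f n), n, i, j.
- move=> x p p' [n [i [j [Rn1 /= -> ->]]]] [m [k [l [Rn2 /= /fI E ->]]]].
  by subst m; case: (Ri _ _ _ Rn1 Rn2) => -> ->.
- move=> x x' p [n [i [j [Rn1 /= -> ->]]]] [m [k [l [Rn2 /= -> []]]]].
  by move=> /fI ? /fI ?; subst k l; rewrite (Rf _ _ _ Rn1 Rn2).
Qed.

(** The empty graph is admitted so that the empty chain has an upper bound; any
    other graph has to contain a fixed infinite pairing, which keeps the field of a
    maximal one infinite.  Such a field cannot embed in its complement, so the
    whole type is at most twice as large as the field. *)
Lemma card_setXT_infinite : infinite_set [set: T] -> [set: T * T] #<= [set: T].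
Proof.
move=> infT; have [G0 PG0 infG0] := pairing_nat infT.
pose P G := pairing G /\ (forall q, G q -> G0 `<=` G).
have [F FP Ft|G [[PG G0G] Gmax]] := @Zorn_bigcup _ P.
  have up q q' : (\bigcup_(X in F) X) q -> (\bigcup_(X in F) X) q' ->
      exists2 G, F G & G q /\ G q'.
    move=> [G FG Gq] [G' FG' Gq'].
    by have [GG'|GG'] := Ft _ _ FG FG'; [exists G' => //; split=> //; exact: GG'|exists G => //; split=> //; exact: GG'].
  have fieldU G x : F G -> field G x -> field (\bigcup_(X in F) X) x.
    by move=> FG [p Gp]; exists p; exists G.
  split; [split|].
  - move=> x p [G FG Gp]; have [[G1 _ _ _] _] := FP _ FG.
    by have [p1 p2] := G1 _ _ Gp; split; exact: fieldU FG _.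
  - move=> a b [p Up] [q Uq]; have [G FG [Gp Gq]] := up _ _ Up Uq.
    have [[_ G2 _ _] _] := FP _ FG.
    by have [|| x Gx] := G2 a b; [exists p|exists q|exists x, G].
  - move=> x p p' Up Uq; have [G FG [Gp Gq]] := up _ _ Up Uq.
    by have [[_ _ G3 _] _] := FP _ FG; exact: G3 Gp Gq.
  - move=> x x' p Up Uq; have [G FG [Gp Gq]] := up _ _ Up Uq.
    by have [[_ _ _ G4] _] := FP _ FG; exact: G4 Gp Gq.
  - move=> q [G FG Gq]; have [_ /(_ _ Gq) G0G] := FP _ FG.
    by apply: subset_trans G0G _ => r Gr; exists G.
have {}G0G : G0 `<=` G.
  have [[q Gq]|nG] := pselect (exists q, G q); first exact: G0G Gq.
  case: (Gmax G0); last by split=> [//|q _]; exact: subset_refl.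
  rewrite properEneq; split; last by move=> q Gq; case: nG; exists q.
  apply/eqP => E; have /infiniteP/card_leT_fun[f _ /(_ 0%N)[p Gp]] := infG0.
  by apply: nG; rewrite E; exists (f 0%N, p).
have infG : infinite_set (field G).
  apply: sub_infinite_set infG0 => x [p Gp]; exists p; exact: G0G.
have DD := pairing_card PG; have DS := csum_setX infG DD.
have TD : [set: T] #<= field G.
  have [CD|DC] := card_le_total (~` field G) (field G).
    rewrite -(setUv (field G)) (card_le_eql (setU_csum _)) //.
    by apply: card_le_trans DS; apply: csum_le; rewrite ?card_lexx.
  have [B BC DB] := card_le_sub DC.
  have [||H PH GH] := pairing_extend PG infG (B := B); [by rewrite card_eq_sym|exact: BC|].
  case: (Gmax H GH); split=> // q _; apply: subset_trans G0G _; exact: properW.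
rewrite -setXTT; apply: card_le_trans (card_le_setX TD TD) _.
by apply: card_le_trans DD _; exact: card_leT.
Qed.

End Hessenberg.

Lemma card_setX_infinite (T : Type) (A : set T) : infinite_set A -> A `*` A #<= A.
Proof.
move=> infA; have eA := card_setT A.
have infT : infinite_set [set: A] by rewrite (eq_finite_set eA).
have := card_setXT_infinite infT; rewrite -setXTT (card_le_eqr eA); apply: card_le_trans.
by apply: card_le_setX; exact: card_eq_ler.
Qed.

Lemma infinite_csum (T : Type) (A : set T) : infinite_set A -> csum A A #<= A.
Proof. by move=> infA; apply: csum_setX => //; exact: card_setX_infinite. Qed.

(** These are the nonzero cardinals that are not the sum of two smaller ones. *)
Definition indecomposable (T : Type) (M : set T) := M #= [set: unit] \/ infinite_set M.

Lemma indecomposable_neq0 (T U : Type) (M : set T) :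
  indecomposable M -> ~ (M #<= @set0 U).
Proof.
rewrite card_le0 => -[m1|infm] /eqP m0; last by apply: infm; rewrite m0; exact: finite_set0.
move: m1; rewrite m0 card_eq_sym card_eq0 => /eqP/(congr1 (fun A => A tt)) E.
by have : [set: unit] tt by []; rewrite E.
Qed.

(** In the infinite case the larger summand [D] has M <= D + D = D. *)
Lemma csum_indecomposable (S T U : Type) (M : set S) (A : set T) (B : set U) :
  indecomposable M -> csum A B #= M -> A #= M \/ B #= M.
Proof.
move=> /[dup] Mi /(@indecomposable_neq0 _ unit) M0 /[dup]/card_eq_lel ABM /card_eq_ler MAB.
have AM := card_le_trans (csum_lel A B) ABM.
have BM := card_le_trans (csum_ler A B) ABM.
case: Mi => [M1|infM].
  have all (V : Type) (C : set V) x : C x -> M #<= C.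
    move=> Cx; rewrite (card_le_eql M1).
    by apply: (@card_le_inj _ _ _ _ (fun _ => x)) => // -[] [].
  have [[x Ax]|A0] := pselect (A !=set0); first by left; apply: card_eq_le2 AM (all _ _ x Ax).
  have [[x Bx]|B0] := pselect (B !=set0); first by right; apply: card_eq_le2 BM (all _ _ x Bx).
  case: M0; apply: card_le_trans MAB _; apply: (@card_le_rel _ _ _ _ (fun _ _ => True)).
    by move=> [x Ax|x Bx]; [case: A0; exists x|case: B0; exists x].
  by move=> [x|x] y t Ax; [case: A0; exists x|case: B0; exists x].
have key (V W : Type) (C : set V) (D : set W) : M #<= csum C D -> C #<= D -> M #<= D.
  move=> MCD CD; have MDD : M #<= csum D D.
    by apply: card_le_trans MCD _; apply: csum_le; rewrite ?card_lexx.
  have infD : infinite_set D.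
    move=> finD; apply: infM; apply: card_le_finite MDD _.
    have -> : csum D D = inl @` D `|` inr @` D.
      apply/seteqP; split=> [[x Dx|x Dx]|p [[x Dx <-]|[x Dx <-]] //]; [left|right];
        by exists x.
    by rewrite finite_setU; split; exact: finite_image.
  by apply: card_le_trans MDD _; exact: infinite_csum.
have [AB|BA] := card_le_total A B; [right|left]; apply: card_eq_le2 => //.
  exact: key MAB AB.
by apply: key BA; apply: card_le_trans MAB _; exact: csumC.
Qed.

(** * Transversals of a product *)

Lemma closed_connected (V : Type) (R : V -> V -> Prop) (S : V -> Prop) p q :
  (forall u v, S u -> R u v -> S v) -> connected R p q -> S p -> S q.
Proof.
by move=> SR; elim=> [u v uv Su|//|u v w _ uv _ vw /uv/vw //]; exact: SR uv.
Qed.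

Section Graphs.
Variable X : Type.
Implicit Types (a b c e k : brauer_graph X) (u v s t : X + X) (x y z : X).

Lemma edge_degl a u v w : a u w -> a v w -> u = v.
Proof. by move=> /edge_sym uw /edge_sym; exact: edge_deg uw. Qed.

Lemma upper_hook a x y : a (inl x) (inl y) -> ~ dom a x.
Proof. by move=> xy [z /(edge_deg xy)]. Qed.

Lemma lower_hook a x y : a (inr x) (inr y) -> ~ codom a x.
Proof. by move=> xy [z /edge_sym/(edge_deg xy)]. Qed.

(** Outside [dom a], a path that starts at an upper vertex runs at most along the
    hook of [a] there, and so never reaches the middle layer. *)
Lemma dom_mul a b : dom (mul_brauer a b) `<=` dom a.
Proof.
move=> x [y [_ xy]]; apply: contrapT => nx.
suff : inl (inl x) = inl (inr y) :> (X + X) + X \/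
    exists2 z, inl (inr y) = inl (inl z) :> (X + X) + X & a (inl x) (inl z).
  by case=> // -[z].
apply: (closed_connected (S := fun p => inl (inl x) = p \/
    exists2 z, p = inl (inl z) & a (inl x) (inl z)) _ xy); last by left.
move=> p q pS [] [s [t [st pE ->]]]; last by case: s st pE pS => z _ -> /= [|[]].
have [xE|[z sE xz]] : inl x = s \/ exists2 z, s = inl z & a (inl x) (inl z).
  by case: s pE {st} pS => z -> /= [E|[w E zw]] //; case: E => ->; [left|right; exists w].
  case: t st => z; rewrite -xE => xz; first by right; exists z.
  by case: nx; exists z.
by left; rewrite sE in st; rewrite -(edge_deg (edge_sym xz) st).
Qed.

Lemma codom_mul a b : codom (mul_brauer a b) `<=` codom b.
Proof.
move=> y [x [_ /(connected_sym (@product_graph_sym _ _ _)) yx]]; apply: contrapT => ny.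
suff : inl (inr y) = inl (inl x) :> (X + X) + X \/
    exists2 z, inl (inl x) = inl (inr z) :> (X + X) + X & b (inr y) (inr z).
  by case=> // -[z].
apply: (closed_connected (S := fun p => inl (inr y) = p \/
    exists2 z, p = inl (inr z) & b (inr y) (inr z)) _ yx); last by left.
move=> p q pS [] [s [t [st pE ->]]]; first by case: s st pE pS => z _ -> /= [|[]].
have [yE|[z sE yz]] : inr y = s \/ exists2 z, s = inr z & b (inr y) (inr z).
  by case: s pE {st} pS => z -> /= [E|[w E zw]] //; case: E => ->; [left|right; exists w].
  case: t st => z; rewrite -yE => yz; last by right; exists z.
  by case: ny; exists z; exact: edge_sym.
by left; rewrite sE in st; rewrite -(edge_deg (edge_sym yz) st).
Qed.

Lemma vee_step a b s t : a s t -> connected (product_graph a b) (vee s) (vee t).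
Proof. by move=> st; apply: rt_step; left; exists s, t. Qed.

Lemma wedge_step a b s t : b s t -> connected (product_graph a b) (wedge s) (wedge t).
Proof. by move=> st; apply: rt_step; right; exists s, t. Qed.

Lemma mul_transversal a b x y z :
  a (inl x) (inr y) -> b (inl y) (inr z) -> mul_brauer a b (inl x) (inr z).
Proof.
by move=> xy yz; split=> //; apply: rt_trans (vee_step b xy) (wedge_step a yz).
Qed.

(** These sets consist of the middle ends of the lost transversals, so that both
    can be compared with the codomain of [a] and the domain of [b]. *)
Definition lost_upper a b : set X :=
  [set y | exists2 x, a (inl x) (inr y) & ~ dom (mul_brauer a b) x].

Definition lost_lower a b : set X :=
  [set y | exists2 z, b (inl y) (inr z) & ~ codom (mul_brauer a b) z].

Lemma lost_upper_sub a b y : lost_upper a b y -> codom a y /\ ~ dom b y.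
Proof.
move=> [x xy nx]; split; first by exists x.
by move=> [z yz]; apply: nx; exists z; exact: mul_transversal xy yz.
Qed.

Lemma lost_lower_sub a b y : lost_lower a b y -> dom b y /\ ~ codom a y.
Proof.
move=> [z yz nz]; split; first by exists z.
by move=> [x xy]; apply: nz; exists x; exact: mul_transversal xy yz.
Qed.

Lemma defect_mul a b :
  defect_set (mul_brauer a b) #= csum (defect_set a) (lost_upper a b).
Proof.
have -> : defect_set (mul_brauer a b) =
    defect_set a `|` (dom a `\` dom (mul_brauer a b)).
  apply/seteqP; split=> x; rewrite /defect_set /=.
    by move=> nx; have [|] := pselect (dom a x); [right|left].
  by move=> [na /dom_mul|[_]].
apply: card_eq_trans (setU_csum _) _; first by move=> x nx [].
apply: csum_eq => //; apply/card_eq_bij_rel.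
exists (fun x y => a (inl x) (inr y) /\ ~ dom (mul_brauer a b) x); split.
- by move=> x y [xy nx]; split; [split=> //; exists y|exists x].
- by move=> x [[y xy] nx]; exists y.
- by move=> y [x xy nx]; exists x.
- by move=> x y y' [/edge_deg xy _] [/xy[]].
- by move=> x x' y [/edge_degl xy _] [/xy[]].
Qed.

Lemma codefect_mul a b :
  codefect_set (mul_brauer a b) #= csum (codefect_set b) (lost_lower a b).
Proof.
have -> : codefect_set (mul_brauer a b) =
    codefect_set b `|` (codom b `\` codom (mul_brauer a b)).
  apply/seteqP; split=> x; rewrite /codefect_set /=.
    by move=> nx; have [|] := pselect (codom b x); [right|left].
  by move=> [na /codom_mul|[_]].
apply: card_eq_trans (setU_csum _) _; first by move=> x nx [].
apply: csum_eq => //; apply/card_eq_bij_rel.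
exists (fun x y => b (inl y) (inr x) /\ ~ codom (mul_brauer a b) x); split.
- by move=> x y [xy nx]; split; [split=> //; exists y|exists x].
- by move=> x [[y xy] nx]; exists y.
- by move=> y [x xy nx]; exists x.
- by move=> x y y' [/edge_degl xy _] [/xy[]].
- by move=> x x' y [/edge_deg xy _] [/xy[]].
Qed.

(** [K] counts the middle vertices outside [dom b] that are not ends of lost
    transversals of [a]: those on no transversal of [a] or [b], and those from which
    a transversal of [a] is continued by a longer path.  Sending the first kind to
    themselves and the second to the far end of the path matches [K] with the
    analogous part of the codefect set of [a]. *)
Lemma defect_common a b : exists K : set X,
  defect_set b #= csum K (lost_upper a b) /\ codefect_set a #= csum K (lost_lower a b).
Proof.
pose K := defect_set b `\` lost_upper a b.
pose K' := codefect_set a `\` lost_lower a b.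
exists K; split.
  have {1}-> : defect_set b = K `|` lost_upper a b.
    apply/seteqP; split=> [x nx|x [[]//|/lost_upper_sub[]//]].
    by have [?|?] := pselect (lost_upper a b x); [right|left].
  by apply: setU_csum => x [].
have -> : codefect_set a = K' `|` lost_lower a b.
  apply/seteqP; split=> [x nx|x [[]//|/lost_lower_sub[]//]].
  by have [?|?] := pselect (lost_lower a b x); [right|left].
apply: card_eq_trans (setU_csum _) _; first by move=> x [].
apply: csum_eq => //; apply: card_esym; apply/card_eq_bij_rel.
pose S y z := exists x w, [/\ a (inl x) (inr y), b (inl z) (inr w) &
  mul_brauer a b (inl x) (inr w)].
have SK y z : S y z -> ~ dom b y -> ~ codom a z.
  move=> [x [w [xy zw xw]]] ny [x' xz]; apply: ny.
  have xx := edge_degl (mul_transversal xz zw) xw; rewrite xx in xz.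
  by case: (edge_deg xy xz) => ->; exists w.
exists (fun y z => [/\ ~ dom b y, ~ codom a z & y = z \/ S y z]); split.
- move=> y z [ny nz yz]; split; split=> //.
    case: yz => [yz|[x [w [xy zw xw]]]] [x' xy' nx']; first by apply: nz; exists x'; rewrite -yz.
    by have [xx] := edge_degl xy xy'; apply: nx'; rewrite -xx; exists w.
  case: yz => [yz|[x [w [xy zw xw]]]] [w' zw' nw']; first by apply: ny; exists w'; rewrite yz.
  by have [ww] := edge_deg zw zw'; apply: nw'; rewrite -ww; exists x.
- move=> y [ny lny]; have [[x xy]|cy] := pselect (codom a y); last first.
    by exists y; split=> //; left.
  have [w xw] : dom (mul_brauer a b) x by apply: contrapT => nx; apply: lny; exists x.
  have [z zw] : codom b w by apply: codom_mul; exists x; exact: xw.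
  have Syz : S y z by exists x, w.
  by exists z; split=> //; [exact: SK Syz ny|right].
- move=> z [nz lnz]; have [[w zw]|dz] := pselect (dom b z); last first.
    by exists z; split=> //; left.
  have [x xw] : codom (mul_brauer a b) w by apply: contrapT => nx; apply: lnz; exists w.
  have [y xy] : dom a x by apply: dom_mul; exists w; exact: xw.
  have Syz : S y z by exists x, w.
  exists y; split=> //; last by right.
  move=> [w' yw']; apply: nz.
  have ww := edge_deg (mul_transversal xy yw') xw; rewrite ww in yw'.
  by case: (edge_degl zw yw') => ->; exists x.
- move=> y z z' [ny nz [yz|[x [w [xy zw xw]]]]] [_ nz' [yz'|[x' [w' [xy' zw' xw']]]]].
  + by rewrite -yz.
  + by case: nz; rewrite -yz; exists x'.
  + by case: nz'; rewrite -yz'; exists x.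
  + have xx := edge_degl xy xy'; rewrite -xx in xw'.
    by have ww := edge_deg xw xw'; rewrite -ww in zw'; case: (edge_degl zw zw').
- move=> y y' z [ny nz [yz|[x [w [xy zw xw]]]]] [ny' _ [yz'|[x' [w' [xy' zw' xw']]]]].
  + by rewrite yz.
  + by case: ny; rewrite yz; exists w'.
  + by case: ny'; rewrite yz'; exists w.
  + have ww := edge_deg zw zw'; rewrite -ww in xw'.
    by have xx := edge_degl xw xw'; rewrite -xx in xy'; case: (edge_deg xy xy').
Qed.

(** * Computing products *)

(** To identify [mul_brauer a b] with [c], retract the product graph onto the outer
    vertices so that edges become paths of [c].  The retraction may depend on the
    vertex [u] whose component is examined, and may therefore collapse the hooks of
    the middle layer onto [u]. *)
Lemma mul_brauer_eq a b c (f : X + X -> X -> X + X) :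
  (forall u, let F p := match p with inl t => t | inr x => f u x end in
    (forall s t, a s t -> connected c (F (vee s)) (F (vee t))) /\
    (forall s t, b s t -> connected c (F (wedge s)) (F (wedge t)))) ->
  (forall u v, c u v -> connected (product_graph a b) (inl u) (inl v)) ->
  mul_brauer a b = c.
Proof.
move=> Fc cP; apply: brauer_ext => u v; split=> [[uv cuv]|cuv].
  apply: connected_brauer => //; have [Fa Fb] := Fc u.
  pose F p := match p with inl t => t | inr x => f u x end.
  apply: (connected_homo (f := F) _ cuv) => p q [] [s [t [st -> ->]]]; first exact: Fa.
  exact: Fb.
by split; [move=> E; move: cuv; rewrite E; exact: edge_irr|exact: cP].
Qed.

Definition star_edge a u v :=
  let swap t := match t with inl x => inr x | inr x => inl x end : X + X in
  a (swap u) (swap v).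

Lemma star_edge_irr a u : ~ star_edge a u u.
Proof. exact: edge_irr. Qed.

Lemma star_edge_sym a u v : star_edge a u v -> star_edge a v u.
Proof. exact: edge_sym. Qed.

Lemma star_edge_deg a u v w : star_edge a u v -> star_edge a u w -> v = w.
Proof.
move=> uv uw; have := edge_deg uv uw.
by case: v w {uv uw} => x [] y //= [->].
Qed.

Definition star a : brauer_graph X :=
  BrauerGraph (@star_edge_irr a) (@star_edge_sym a) (@star_edge_deg a).

Lemma starK a : star (star a) = a.
Proof. by apply: brauer_ext => -[] x [] y. Qed.

Lemma image_or_default a (F : X -> X + X) : exists g : X + X -> X -> X + X,
  (forall u x y, a (inl x) (inr y) -> g u x = F y) /\
  (forall u x, ~ dom a x -> g u x = u).
Proof.
have /choice[g gP] (p : (X + X) * X) : exists w,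
    (forall y, a (inl p.2) (inr y) -> w = F y) /\ (~ dom a p.2 -> w = p.1).
  have [[y xy]|n] := pselect (dom a p.2).
    by exists (F y); split=> [z /(edge_deg xy)[->]//|[]]; exists y.
  by exists p.1; split=> // y xy; case: n; exists y.
exists (fun u x => g (u, x)); split=> [u x y|u x]; first by case: (gP (u, x)) => H _; exact: H.
by case: (gP (u, x)) => _; apply.
Qed.

Lemma codefect0_codom a : codefect_set a = set0 -> forall y, codom a y.
Proof.
by move=> a0 y; apply: contrapT => ny; have : codefect_set a y by []; rewrite a0.
Qed.

(** The middle vertex [x] retracts to the upper vertex at the end of its
    transversal. *)
Lemma star_mul a : codefect_set a = set0 -> mul_brauer (star a) a = one_brauer X.
Proof.
move=> a0; have aT := codefect0_codom a0.
have nolow x y : ~ a (inr x) (inr y) by move=> /lower_hook; apply; exact: aT.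
have one1 x : one_brauer X (inl x) (inr x) by exists x; left.
have one2 x : one_brauer X (inr x) (inl x) by exists x; right.
have [g [gT gN]] := image_or_default a inl.
apply: (mul_brauer_eq (f := g)) => [u F|u v].
  have G1 x y : a (inl x) (inr y) -> g u x = inl y by exact: gT.
  have G2 x y : a (inl x) (inl y) -> g u x = u by move=> /upper_hook; exact: gN.
  split=> -[] x [] y //=; rewrite /star_edge /=.
  - by move/nolow.
  - by move/edge_sym/G1 => ->; exact: rt_refl.
  - by move/G1 => ->; exact: rt_refl.
  - by move=> xy; rewrite (G2 _ _ xy) (G2 _ _ (edge_sym xy)); exact: rt_refl.
  - by move=> xy; rewrite (G2 _ _ xy) (G2 _ _ (edge_sym xy)); exact: rt_refl.
  - by move/G1 => ->; apply: rt_step; exact: one1.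
  - by move/edge_sym/G1 => ->; apply: rt_step; exact: one2.
  - by move/nolow.
have E z : connected (product_graph (star a) a) (inl (inl z)) (inl (inr z)).
  have [x xz] := aT z.
  apply: rt_trans (rt_step _ _ _ _ _) (rt_step _ _ _ _ _); first last.
    by right; exists (inl x), (inr z).
  by left; exists (inl z), (inr x); split=> //; exact: edge_sym.
move=> [z [] [-> ->]]; first exact: E.
exact: connected_sym (@product_graph_sym _ _ _) _ _ (E z).
Qed.

Lemma left_unitP a : @left_units (brauer_graph X) a <-> codefect_set a = set0.
Proof.
split=> [[b ba]|/star_mul]; last by exists (star a).
apply/seteqP; split=> // y; apply; apply: (@codom_mul b a).
by have -> : mul_brauer b a = one_brauer X := ba; exists y; exists y; left.
Qed.

(** Reflection reverses products, and exchanges defect and codefect. *)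
Lemma unitP a : GX X a <-> defect_set a = set0 /\ codefect_set a = set0.
Proof.
split=> [[/left_unitP -> [b ab]]|[a0 a1]]; last first.
  split; first exact/left_unitP.
  exists (star a); rewrite -{1}(starK a); apply: star_mul.
  by rewrite -a0; apply/seteqP; split=> x nx [y xy]; apply: nx; exists y; exact: edge_sym.
split=> //; apply/seteqP; split=> // x; apply; apply: (@dom_mul a b).
by have -> : mul_brauer a b = one_brauer X := ab; exists x; exists x; left.
Qed.

(** The left unit with transversals from [h y] to [y], and no hooks; a unit when [h]
    is a bijection. *)
Definition inj_edge (h : X -> X) u v :=
  match u, v with
  | inl x, inr y | inr y, inl x => x = h y
  | _, _ => False
  end.

Lemma inj_edge_irr h u : ~ inj_edge h u u.
Proof. by case: u => x []. Qed.

Lemma inj_edge_sym h u v : inj_edge h u v -> inj_edge h v u.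
Proof. by case: u v => x []. Qed.

Lemma inj_edge_deg h : injective h -> forall u v w, inj_edge h u v -> inj_edge h u w -> v = w.
Proof. by move=> hI [] x [] y [] z //= -> => [/hI|] ->. Qed.

Definition inj_brauer h (hI : injective h) : brauer_graph X :=
  BrauerGraph (@inj_edge_irr h) (@inj_edge_sym h) (inj_edge_deg hI).

(** Relabelling the upper vertices of [a], which is what multiplying by a unit on
    the left does. *)
Definition pull_edge (g : X -> X) a u v :=
  let G t := match t with inl x => inl (g x) | inr x => inr x end : X + X in
  a (G u) (G v).

Lemma pull_edge_irr g a u : ~ pull_edge g a u u.
Proof. exact: edge_irr. Qed.

Lemma pull_edge_sym g a u v : pull_edge g a u v -> pull_edge g a v u.
Proof. exact: edge_sym. Qed.

Lemma pull_edge_deg g a : injective g ->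
  forall u v w, pull_edge g a u v -> pull_edge g a u w -> v = w.
Proof.
move=> gI u v w uv uw; have := edge_deg uv uw.
by case: v w {uv uw} => x [] y //= [/gI ->].
Qed.

Definition pull_brauer g (gI : injective g) a : brauer_graph X :=
  BrauerGraph (@pull_edge_irr g a) (@pull_edge_sym g a) (pull_edge_deg gI).

Lemma mul_inj_brauer g h (gI : injective g) (hI : injective h) a :
  cancel g h -> cancel h g -> mul_brauer (inj_brauer hI) a = pull_brauer gI a.
Proof.
move=> gh hg; apply: (mul_brauer_eq (f := fun _ x => inl (h x))) => [_|u v uv].
  split=> -[] x [] y //=; try by move=> ->; exact: rt_refl.
  - by move=> xy; apply: rt_step; rewrite /= /pull_edge !hg.
  - by move=> xy; apply: rt_step; rewrite /= /pull_edge !hg.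
  - by move=> xy; apply: rt_step; rewrite /= /pull_edge !hg.
  - by move=> xy; apply: rt_step.
pose G (t : X + X) : X + X := match t with inl x => inl (g x) | inr x => inr x end.
have cG t : connected (product_graph (inj_brauer hI) a) (inl t) (wedge (G t)).
  case: t => x; last exact: rt_refl.
  by apply: rt_step; left; exists (inl x), (inr (g x)); split=> //=; rewrite gh.
apply: rt_trans (cG u) _; apply: rt_trans (connected_sym (@product_graph_sym _ _ _) (cG v)).
exact: wedge_step.
Qed.

Lemma inj_codefect h (hI : injective h) : codefect_set (inj_brauer hI) = set0.
Proof. by apply/seteqP; split=> // y; apply; exists (h y). Qed.

Lemma inj_unit g h (hI : injective h) : cancel g h -> GX X (inj_brauer hI).
Proof.
move=> gh; apply/unitP; split; last exact: inj_codefect.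
by apply/seteqP; split=> // x; apply; exists (g x); rewrite /= gh.
Qed.

Definition matching_on (D : set X) (U : X -> X -> Prop) :=
  [/\ forall x y, U x y -> D x, forall x, ~ U x x, forall x y, U x y -> U y x &
      forall x y z, U x y -> U x z -> y = z].

(** The identity off [D], with arbitrary hooks [U] above and [L] below inside [D]. *)
Definition block_edge (D : set X) (U L : X -> X -> Prop) u v :=
  match u, v with
  | inl x, inl y => U x y
  | inr x, inr y => L x y
  | inl x, inr y | inr x, inl y => x = y /\ ~ D x
  end.

Section Block.
Variables (D : set X) (U L : X -> X -> Prop).
Hypotheses (UD : matching_on D U) (LD : matching_on D L).

Lemma block_edge_irr u : ~ block_edge D U L u u.
Proof. by case: u => x; [case: UD|case: LD] => _ I _ _; exact: I. Qed.

Lemma block_edge_sym u v : block_edge D U L u v -> block_edge D U L v u.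
Proof.
by case: u v => x [] y /=; try (by case=> ->); [case: UD|case: LD] => _ _ S _; exact: S.
Qed.

Lemma block_edge_deg u v w : block_edge D U L u v -> block_edge D U L u w -> v = w.
Proof.
case: UD LD => [UD1 _ _ UD2] [LD1 _ _ LD2].
case: u v w => x [] y [] z //=.
- by move=> /UD2 xy /xy ->.
- by move=> /UD1 Dx [].
- by move=> [_ nD] /UD1.
- by move=> [<-] _ [<-].
- by move=> [<-] _ [<-].
- by move=> [_ nD] /LD1.
- by move=> /LD1 Dx [].
- by move=> /LD2 xy /xy ->.
Qed.

Definition block : brauer_graph X :=
  BrauerGraph block_edge_irr block_edge_sym block_edge_deg.

Lemma block_idem : mul_brauer block block = block.
Proof.
case: (UD) (LD) => [UD1 _ US UD2] [LD1 _ LS LD2].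
have /choice[g gP] (p : (X + X) * X) : exists w,
    (~ D p.2 -> w = inl p.2) /\ (D p.2 -> w = p.1).
  by have [?|?] := pselect (D p.2); [exists p.1|exists (inl p.2)].
apply: (mul_brauer_eq (f := fun u x => g (u, x))) => [u F|].
  have G1 x : ~ D x -> g (u, x) = inl x by case: (gP (u, x)).
  have G2 x : D x -> g (u, x) = u by case: (gP (u, x)).
  have HU x y : U x y -> g (u, x) = g (u, y).
    by move=> xy; rewrite !G2 //; [exact: UD1 (US _ _ xy)|exact: UD1 xy].
  have HL x y : L x y -> g (u, x) = g (u, y).
    by move=> xy; rewrite !G2 //; [exact: LD1 (LS _ _ xy)|exact: LD1 xy].
  split=> -[] x [] y /=.
  - by move=> xy; exact: rt_step.
  - by move=> [-> nD]; rewrite G1 //; exact: rt_refl.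
  - by move=> [-> nD]; rewrite G1 //; exact: rt_refl.
  - by move=> /HL ->; exact: rt_refl.
  - by move=> /HU ->; exact: rt_refl.
  - by move=> [-> nD]; rewrite G1 //; apply: rt_step.
  - by move=> [-> nD]; rewrite G1 //; apply: rt_step.
  - by move=> xy; exact: rt_step.
have E x : ~ D x -> connected (product_graph block block) (inl (inl x)) (inl (inr x)).
  move=> nD; apply: rt_trans (rt_step _ _ _ _ _) (rt_step _ _ _ _ _); first last.
    by right; exists (inl x), (inr x).
  by left; exists (inl x), (inr x).
move=> [] x [] y /=.
- by move=> xy; exact: (vee_step block (a := block) (s := inl x) (t := inl y)).
- by move=> [-> nD]; exact: E.
- by move=> [-> nD]; apply: connected_sym (@product_graph_sym _ _ _) _ _ (E _ nD).
- by move=> xy; exact: (wedge_step block (b := block) (s := inr x) (t := inr y)).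
Qed.

End Block.

(** The idempotent [e] is the identity on [dom a].  It has the upper hooks of [a],
    and lower hooks which the transversals of [k] carry to the lower hooks of [a]. *)
Lemma factor_extension a k : codefect_set k = set0 ->
  (forall x y, a (inl x) (inr y) -> k (inl x) (inr y)) ->
  exists2 e, mul_brauer e e = e & mul_brauer e k = a.
Proof.
move=> k0 ak; have kT := codefect0_codom k0.
have nolow x y : ~ k (inr x) (inr y) by move=> /lower_hook; apply; exact: kT.
pose D := defect_set a; pose U x y := a (inl x) (inl y).
pose L x y := [/\ D x, D y & exists z w,
  [/\ k (inl x) (inr z), k (inl y) (inr w) & a (inr z) (inr w)]].
have UD : matching_on D U.
  split; [by move=> x y /upper_hook|by move=> x; exact: edge_irr|by move=> x y; exact: edge_sym|].
  by move=> x y z /edge_deg xy /xy[].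
have LD : matching_on D L.
  split; first by move=> x y [].
  - by move=> x [_ _ [z [w [xz /(edge_deg xz)[<-] /edge_irr]]]].
  - move=> x y [Dx Dy [z [w [xz yw zw]]]]; split=> //; exists w, z; split=> //.
    exact: edge_sym.
  - move=> x y y' [_ _ [z [w [xz yw zw]]]] [_ _ [z' [w' [xz' yw' zw']]]].
    case: (edge_deg xz xz') => zz; rewrite -zz in zw'.
    case: (edge_deg zw zw') => ww; rewrite -ww in yw'.
    by case: (edge_degl yw yw').
exists (block UD LD); first exact: block_idem.
have [g [gT gN]] := image_or_default k inr.
apply: (mul_brauer_eq (f := g)) => [u F|].
  have G1 x y : k (inl x) (inr y) -> g u x = inr y by exact: gT.
  have G2 x y : k (inl x) (inl y) -> g u x = u by move=> /upper_hook; exact: gN.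
  have T x : ~ D x -> exists2 y, g u x = inr y & a (inl x) (inr y).
    by move=> /contrapT[y xy]; exists y => //; apply: G1; exact: ak.
  split=> -[] x [] y /=.
  - by move=> xy; exact: rt_step.
  - by move=> [<- /T[z -> xz]]; exact: rt_step.
  - by move=> [<- /T[z -> xz]]; apply: rt_step; exact: edge_sym.
  - by move=> [_ _ [z [w [/G1 -> /G1 -> zw]]]]; exact: rt_step.
  - by move=> xy; rewrite (G2 _ _ xy) (G2 _ _ (edge_sym xy)); exact: rt_refl.
  - by move=> /G1 ->; exact: rt_refl.
  - by move=> /edge_sym/G1 ->; exact: rt_refl.
  - by move/nolow.
have E x y : a (inl x) (inr y) -> connected (product_graph (block UD LD) k) (inl (inl x)) (inl (inr y)).
  move=> xy; apply: rt_trans (rt_step _ _ _ _ _) (rt_step _ _ _ _ _); first last.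
    by right; exists (inl x), (inr y); split=> //; exact: ak.
  by left; exists (inl x), (inr x); split=> //=; split=> //; apply; exists y.
move=> [] x [] y /= xy.
- exact: (vee_step k (a := block UD LD) (s := inl x) (t := inl y)).
- exact: E.
- by apply: connected_sym (@product_graph_sym _ _ _) _ _ (E _ _ (edge_sym xy)).
- have DD z z' w : a (inr z) (inr z') -> k (inl w) (inr z) -> D w.
    move=> zz wz [t wt]; apply: (lower_hook zz).
    by case: (edge_deg wz (ak _ _ wt)) => ->; exists w.
  have [z zx] := kT x; have [w wy] := kT y.
  apply: (rt_trans _ _ _ (inr z)).
    by apply: (wedge_step _ (s := inr x) (t := inl z)); exact: edge_sym.
  apply: (rt_trans _ _ _ (inr w)); last by apply: (wedge_step _ (s := inl w) (t := inr y)).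
  apply: (vee_step k (a := block UD LD) (s := inr z) (t := inr w)); split.
  + exact: DD xy zx.
  + exact: DD (edge_sym xy) wy.
  + by exists x, y.
Qed.

(** The unit [g] carries the defect set of [a] onto the defect set of [k] together
    with the upper ends of those transversals of [k] that end in the codefect set
    of [a]; the hypothesis says exactly that these sets are equipotent. *)
Lemma factor_codefect a k : codefect_set k = set0 ->
  defect_set a #= csum (codefect_set a) (defect_set k) ->
  exists e g, [/\ mul_brauer e e = e, GX X g & mul_brauer e (mul_brauer g k) = a].
Proof.
move=> k0 ak; have kT := codefect0_codom k0.
pose R x z := exists2 v, a (inl x) (inr v) & k (inl z) (inr v).
pose B := [set z | exists2 v : X, k (inl z) (inr v) & codom a v].
have RB : bij_rel (dom a) B R.
  split.
  - by move=> x z [v xv zv]; split; exists v => //; exists x.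
  - by move=> x [v xv]; have [z zv] := kT v; exists z, v.
  - by move=> z [v zv [x xv]]; exists x, v.
  - by move=> x z z' [v xv zv] [v' /(edge_deg xv)[<-] /(edge_degl zv)[]].
  - by move=> x x' z [v xv zv] [v' xv' /(edge_deg zv)[vv]]; rewrite -vv in xv'; case: (edge_degl xv xv').
have cB : ~` dom a #= ~` B.
  apply: card_eq_trans ak _; apply: card_esym.
  have -> : ~` B = [set z | exists2 v : X, k (inl z) (inr v) & ~ codom a v] `|` defect_set k.
    apply/seteqP; split=> z /=.
      have [[v zv]|] := pselect (dom k z); last by right.
      by move=> nB; left; exists v => // av; apply: nB; exists v.
    move=> [[v zv nv] [w /(edge_deg zv)[<-]//]|nk [v zv _]].
    by apply: nk; exists v.
  apply: card_eq_trans (setU_csum _) _; first by move=> z [v zv _]; apply; exists v.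
  apply: csum_eq => //; apply/card_eq_bij_rel.
  exists (fun z (v : X) => k (inl z) (inr v) /\ ~ codom a v); split.
  - by move=> z v [zv nv]; split=> //; exists v.
  - by move=> z [v zv nv]; exists v.
  - by move=> v nv; have [z zv] := kT v; exists z.
  - by move=> z v v' [/edge_deg zv _] [/zv[]].
  - by move=> z z' v [/edge_degl zv _] [/zv[]].
have [g [h [gh hg gR]]] := bij_rel_extend RB cB.
have gI := can_inj gh; have hI := can_inj hg.
have [||e ee ea] := @factor_extension a (pull_brauer gI k).
- by rewrite -k0; apply/seteqP; split=> y; rewrite k0 //; apply; have [z zy] := kT y; exists (h z); rewrite /= /pull_edge hg.
- move=> x y xy; have [|v xv gv] := gR x; first by exists y.
  by case: (edge_deg xy xv) => ->.
exists e, (inj_brauer hI); split=> //; first exact: inj_unit gh.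
by rewrite (mul_inj_brauer gI hI k gh hg).
Qed.

(** * Arithmetic of defects *)

Definition codef_le_def a := codefect_set a #<= defect_set a.

(** codef(b) + M <= def(b) + M = K + L + M = codef(a) + L <= def(a) + L. *)
Lemma codef_le_def_mul a b :
  codef_le_def a -> codef_le_def b -> codef_le_def (mul_brauer a b).
Proof.
move=> la lb; have [K [bK aK]] := defect_common a b.
have ab := defect_mul a b; have ab' := codefect_mul a b.
apply: card_le_trans (card_eq_lel ab') _.
apply: card_le_trans (card_eq_ler ab).
apply: card_le_trans (csum_le (card_le_trans lb (card_eq_lel bK)) (card_lexx _)) _.
apply: card_le_trans (csumAC _ _ _) _.
exact: csum_le (card_le_trans (card_eq_ler aK) la) (card_lexx _).
Qed.

(** def(b) = K + L <= codef(a) + L <= def(a) + L. *)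
Lemma defect_right_le a b :
  codef_le_def a -> defect_set b #<= defect_set (mul_brauer a b).
Proof.
move=> la; have [K [bK aK]] := defect_common a b.
apply: card_le_trans (card_eq_lel bK) _.
apply: card_le_trans (card_eq_ler (defect_mul a b)).
apply: csum_le (card_lexx _); apply: card_le_trans la.
exact: card_le_trans (csum_lel _ _) (card_eq_ler aK).
Qed.

(** If [ee = e] then no transversal of [e] is lost, from either side. *)
Lemma defect_idem e : mul_brauer e e = e -> codefect_set e #= defect_set e.
Proof.
move=> ee; have [K [dK cK]] := defect_common e e.
apply: card_eq_trans cK (card_esym (card_eq_trans dK _)); apply: csum_eq => //.
have -> : lost_upper e e = set0.
  by apply/seteqP; split=> // y [x xy]; rewrite ee; apply; exists y.
have -> // : lost_lower e e = set0.
by apply/seteqP; split=> // y [x xy]; rewrite ee; apply; exists y.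
Qed.

(** def(a) and def(b) are both at most def(ab), which is 0. *)
Lemma unit_factors a b : codef_le_def a -> codef_le_def b ->
  GX X (mul_brauer a b) -> GX X a /\ GX X b.
Proof.
move=> la lb /unitP[ab0 _].
have empty c : codef_le_def c -> defect_set c #<= defect_set (mul_brauer a b) -> GX X c.
  rewrite /codef_le_def ab0 card_le0 => + /eqP c0; rewrite c0 card_le0 => /eqP cc0.
  exact/unitP.
split; apply: empty => //; last exact: defect_right_le.
exact: card_le_trans (csum_lel _ _) (card_eq_ler (defect_mul a b)).
Qed.

(** Here every middle vertex is met by transversals from both sides or from
    neither, so none is lost. *)
Lemma mul_aligned a b : codefect_set a = defect_set b ->
  defect_set (mul_brauer a b) #= defect_set a /\
  codefect_set (mul_brauer a b) #= codefect_set b.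
Proof.
move=> ab; have E y : codom a y <-> dom b y.
  have : codefect_set a y <-> defect_set b y by rewrite ab.
  by rewrite /codefect_set /defect_set /=; split; apply: contraPP; tauto.
split.
  have := defect_mul a b; have -> : lost_upper a b = set0; last by move/card_eq_trans; apply; exact: csum_set0.
  by apply/seteqP; split=> // y /lost_upper_sub[/E].
have := codefect_mul a b; have -> : lost_lower a b = set0; last by move/card_eq_trans; apply; exact: csum_set0.
by apply/seteqP; split=> // y /lost_lower_sub[/E].
Qed.

(** All middle vertices are ends of transversals of [a], so the transversals of [b]
    survive, and those of [a] are lost at the defect set of [b]. *)
Lemma mul_left_units a b : codefect_set a = set0 -> codefect_set b = set0 ->
  codefect_set (mul_brauer a b) = set0 /\
  defect_set (mul_brauer a b) #= csum (defect_set a) (defect_set b).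
Proof.
move=> a0 b0; have aT := codefect0_codom a0.
split.
  apply/eqP; rewrite -(@card_eq0 _ X); apply: card_eq_trans (codefect_mul a b) _.
  rewrite b0; have -> : lost_lower a b = set0.
    by apply/seteqP; split=> // y /lost_lower_sub[].
  exact: csum_set0.
apply: card_eq_trans (defect_mul a b) _; apply: csum_eq => //.
have -> // : lost_upper a b = defect_set b.
apply/seteqP; split=> y; first by move/lost_upper_sub => [].
move=> ny; have [x xy] := aT y; exists x => // -[z xz].
have [w wz] : codom b z by apply: codom_mul; exists x; exact: xz.
have [x' xw] := aT w; apply: ny; exists z.
have xx := edge_degl (mul_transversal xw wz) xz; rewrite xx in xw.
by case: (edge_deg xy xw) => ->.
Qed.

Definition defect_jump (mu : set X) a :=
  codefect_set a #< mu /\ defect_set a #= mu.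

(** As def(a) + L = mu, either L = mu, and then def(b) = mu because L <= def(b) <=
    def(ab), or def(a) = mu.  In the second case [a] has the property unless
    codef(a) = K + M = mu.  Then K = mu, since M <= codef(ab) < mu, and again
    def(b) = mu. *)
Lemma defect_jump_mul (mu : set X) a b : indecomposable mu ->
  codef_le_def a -> codef_le_def b ->
  defect_jump mu (mul_brauer a b) -> defect_jump mu a \/ defect_jump mu b.
Proof.
move=> imu la lb [/card_ltP[cmu nmu] dmu].
have [K [bK aK]] := defect_common a b.
have ab := defect_mul a b; have ab' := codefect_mul a b.
have cb : codefect_set b #< mu.
  have bab := card_le_trans (csum_lel (codefect_set b) (lost_lower a b)) (card_eq_ler ab').
  by apply/card_ltP; split=> [|mub]; [exact: card_le_trans cmu|apply: nmu; exact: card_le_trans bab].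
have db : mu #<= defect_set b -> defect_jump mu a \/ defect_jump mu b.
  move=> mub; right; split=> //; apply: card_eq_le2 => //.
  exact: card_le_trans (defect_right_le b la) (card_eq_lel dmu).
have [aE|lE] := csum_indecomposable imu (card_eq_trans (card_esym ab) dmu); last first.
  apply: db; apply: card_le_trans (card_eq_ler lE) _.
  exact: card_le_trans (csum_ler _ _) (card_eq_ler bK).
have [mua|nmua] := boolP (mu #<= codefect_set a); last first.
  left; split=> //; apply/card_ltP; split; last exact/negP.
  exact: card_le_trans la (card_eq_lel aE).
have cE : codefect_set a #= mu by apply: card_eq_le2 => //; exact: card_le_trans la (card_eq_lel aE).
have [kE|lE] := csum_indecomposable imu (card_eq_trans (card_esym aK) cE).
  apply: db; apply: card_le_trans (card_eq_ler kE) _.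
  exact: card_le_trans (csum_lel _ _) (card_eq_ler bK).
case: nmu; apply: card_le_trans (card_eq_ler lE) _.
exact: card_le_trans (csum_ler _ _) (card_eq_ler ab').
Qed.

End Graphs.

(** * Generated subsemigroups *)

Section Generation.
Variable S : semigroupType.
Implicit Types (U V M : set S).

Lemma sgen_sub U : U `<=` sgen U.
Proof. exact: sub_gen_smallest. Qed.

Lemma sgen_subsemigroup U : subsemigroup (sgen U).
Proof.
by move=> x y Ux Uy M MP; case: (MP) => sM _; apply: sM; [exact: Ux|exact: Uy].
Qed.

Lemma sgen_min U M : subsemigroup M -> U `<=` M -> sgen U `<=` M.
Proof. exact: smallest_sub. Qed.

Lemma sgen_mono U V : U `<=` V -> sgen U `<=` sgen V.
Proof.
move=> UV; apply: sgen_min; first exact: sgen_subsemigroup.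
exact: subset_trans UV (@sgen_sub V).
Qed.

Let word_val := fix val (x : S) (s : seq S) {struct s} : S :=
  match s with [::] => x | y :: s => (x * val y s)%g end.

Let letters U := fix letters (s : seq S) : Prop :=
  match s with [::] => True | y :: s => U y /\ letters s end.

(** A product is determined by a word over [U], and a word by its length together
    with an element of [C] that codes its letters through a pairing on [C]. *)
Lemma card_sgen (T : Type) (C : set T) U :
  infinite_set C -> U #<= C -> sgen U #<= C.
Proof.
move=> infC UC; have /infiniteP/card_leT_fun[f fI fC] := infC.
have [D DC /card_eq_bij_rel[R [RP RU _ _ Ri]]] := card_le_sub UC.
have [D' DC' /card_eq_bij_rel[P [PP PC _ _ Pi]]] := card_le_sub (card_setX_infinite infC).
have /choice[g gR] x : exists y, U x -> R x y.
  by have [/RU[y Rxy]|] := pselect (U x); [exists y|exists (f 0)].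
have /choice[p pP] q : exists y, (C `*` C) q -> P q y.
  by have [/PC[y Pqy]|] := pselect ((C `*` C) q); [exists y|exists (f 0)].
have gC x : U x -> C (g x) by move=> /gR/RP[_ /DC].
have gI x y : U x -> U y -> g x = g y -> x = y.
  by move=> /gR Rx /gR Ry E; rewrite E in Rx; exact: Ri Rx Ry.
have pC a b : C a -> C b -> C (p (a, b)).
  by move=> Ca Cb; have /PP[_ /DC'] := pP (a, b) (conj Ca Cb).
have pI a b a' b' : C a -> C b -> C a' -> C b' -> p (a, b) = p (a', b') ->
    a = a' /\ b = b'.
  move=> Ca Cb Ca' Cb' E; have Pa := pP (a, b) (conj Ca Cb).
  by have Pa' := pP (a', b') (conj Ca' Cb'); rewrite E in Pa; case: (Pi _ _ _ Pa Pa').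
pose code := fix code (s : seq S) : T :=
  match s with [::] => f 0 | x :: s => p (g x, code s) end.
have codeC s : letters U s -> C (code s).
  by elim: s => [_|x s IH [Ux /IH]] //=; apply: pC; exact: gC.
have codeI s t : letters U s -> letters U t -> size s = size t -> code s = code t -> s = t.
  elim: s t => [|x s IH] [|y t] //= [Ux Us] [Uy Ut] [st] E.
  have [gxy cst] := pI _ _ _ _ (gC _ Ux) (codeC _ Us) (gC _ Uy) (codeC _ Ut) E.
  by rewrite (gI _ _ Ux Uy gxy) (IH t).
have words z : sgen U z -> exists x s, [/\ U x, letters U s & word_val x s = z].
  apply: (sgen_min (M := [set z | exists x s, [/\ U x, letters U s & word_val x s = z]])) z.
    move=> _ _ [x [s [Ux Us <-]]] [y [t [Uy Ut <-]]]; exists x, (s ++ y :: t).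
    elim: s x Ux Us => [|x' s IH] x Ux => [_|[Ux' Us]] //=.
    by have [_ st ->] := IH _ Ux' Us; split=> //; rewrite mulgA.
  by move=> x Ux; exists x, [::].
apply: (@card_le_rel _ _ _ _ (fun z c => exists x s, [/\ U x, letters U s, word_val x s = z &
    c = p (f (size s), code (x :: s))])).
  move=> z /words[x [s [Ux Us xsz]]]; exists (p (f (size s), code (x :: s))).
    by apply: pC => //; apply: codeC.
  by exists x, s.
move=> z z' c _ _ [x [s [Ux Us <- ->]]] [x' [s' [Ux' Us' <- E]]].
have cs : C (code (x :: s)) by apply: codeC.
have cs' : C (code (x' :: s')) by apply: codeC.
have [/fI ss E'] := pI _ _ _ _ (fC _) cs (fC _) cs' E.
have sE : size (x :: s) = size (x' :: s') by rewrite /= ss.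
by case: (codeI (x :: s) (x' :: s') (conj Ux Us) (conj Ux' Us') sE E') => -> ->.
Qed.

End Generation.

(** * Generating F over the idempotents *)

Section RelativeRank.
Variable X : Type.
Hypothesis infX : infinite_set [set: X].
Implicit Types (a b : brauer_graph X) (Om : set (brauer_graph X)) (mu nu : set X).

Lemma FXL_codef_le_def : FXL X `<=` @codef_le_def X.
Proof.
apply: sgen_min => [a b|a [aa|/left_unitP a0]]; first exact: codef_le_def_mul.
  exact: card_eq_lel (defect_idem aa).
by rewrite /codef_le_def a0 card_ge0.
Qed.

Lemma EX_FXL : EX X `<=` FXL X.
Proof. by apply: sgen_mono; left. Qed.

Lemma GX_FXL : GX X `<=` FXL X.
Proof. by move=> a [la _]; apply: sgen_sub; right. Qed.

Lemma GX_subsemigroup : subsemigroup (GX X).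
Proof.
move=> a b /unitP[a0 a1] /unitP[b0 b1]; apply/unitP.
have [|d c] := @mul_aligned X a b; first by rewrite a1.
by move: d c; rewrite a0 b1 !card_eq0 => /eqP ? /eqP ?.
Qed.

(** Among graphs with codef <= def a product is a unit only when both factors are,
    and an invertible idempotent is 1. *)
Lemma EX_unit a : EX X a -> GX X a -> a = one_brauer X.
Proof.
move=> Ea; have : codef_le_def a /\ (GX X a -> a = one_brauer X); last by case.
apply: (sgen_min (M := [set a | codef_le_def a /\ (GX X a -> a = one_brauer X)])) Ea.
  move=> b c [lb ub] [lc uc]; split; first exact: codef_le_def_mul.
  move=> /(unit_factors lb lc)[/ub -> /uc ->]; exact: mul1_brauer.
move=> e ee; split; first exact: card_eq_lel (defect_idem ee).
move=> [[f fe1] _]; have fe : mul_brauer f e = one_brauer X := fe1.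
have ee' : mul_brauer e e = e := ee.
by rewrite -[LHS]mul1_brauer -{1}fe -mul_brauerA ee'.
Qed.

Lemma csum_setT (A : set X) : csum [set: X] A #= [set: X].
Proof.
apply: card_eq_le2; last exact: csum_lel.
apply: card_le_trans (infinite_csum infX); apply: csum_le; [exact: card_lexx|exact: card_leT].
Qed.

(** Split [X] into two copies of itself and exchange the corresponding points with
    index in [A]. *)
Lemma involutions : exists F : set X -> brauer_graph X,
  injective F /\ forall A, mul_brauer (F A) (F A) = one_brauer X.
Proof.
have /card_eq_bij_rel[R [RP RT TR Rf Ri]] := csum_setT setT.
have /choice[f fR] x : exists y, R x y by apply: RT; case: x.
have /choice[k kR] y : exists x, R x y by exact: TR.
have fk : cancel f k by move=> x; apply: Ri (kR _) (fR _).
have kf : cancel k f by move=> y; apply: Rf (fR _) (kR _).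
pose h (A : set X) x := match k x with
  | inl z => if pselect (A z) then f (inr z) else x
  | inr z => if pselect (A z) then f (inl z) else x end.
have hK A : involutive (h A).
  move=> x; rewrite {2}/h; case E: (k x) => [z|z]; case: pselect => Az /=.
  - by rewrite /h fk; case: pselect => //= _; rewrite -E kf.
  - by rewrite /h E; case: pselect => //=.
  - by rewrite /h fk; case: pselect => //= _; rewrite -E kf.
  - by rewrite /h E; case: pselect => //=.
have hI A := can_inj (hK A).
exists (fun A => inj_brauer (hI A)); split=> [A B AB|A].
  apply/seteqP; split=> z; move: AB => /(congr1 (fun a : brauer_graph X => a (inl (f (inr z))) (inr (f (inl z))))).
    rewrite /= /h fk; case: pselect => //= Az; case: pselect => //= nB E _.
    by have /(can_inj fk) : f (inr z) = f (inl z) by rewrite -E.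
  rewrite /= /h fk; case: pselect => //= Az; case: pselect => //= nB E _.
  by have /(can_inj fk) : f (inr z) = f (inl z) by rewrite E.
rewrite (mul_inj_brauer (hI A) (hI A) _ (hK A) (hK A)); apply: brauer_ext => u v.
split=> [|[x [[-> ->]|[-> ->]]]]; rewrite /= /pull_edge //.
case: u v => x [] y //=.
  by move=> /hI ->; exists y; left.
by move=> /hI ->; exists x; right.
Qed.

Lemma units_generated Om : Om `<=` FXL X -> FXL X = sgen (EX X `|` Om) ->
  GX X = sgen (GX X `&` Om).
Proof.
move=> OF FE; apply/seteqP; split; last first.
  by apply: sgen_min; [exact: GX_subsemigroup|move=> a []].
have gen a : GX X a -> a = one_brauer X \/ sgen (GX X `&` Om) a.
  move=> Ga; have := GX_FXL Ga; rewrite FE => Fa.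
  suff [_] : codef_le_def a /\ (GX X a -> a = one_brauer X \/ sgen (GX X `&` Om) a) by exact.
  apply: (sgen_min (M := [set a | codef_le_def a /\
    (GX X a -> a = one_brauer X \/ sgen (GX X `&` Om) a)])) Fa.
    move=> b c [lb ub] [lc uc]; split; first exact: codef_le_def_mul.
    move=> /(unit_factors lb lc)[/ub [->|b1] /uc[->|c1]].
    - by left; exact: mul1_brauer.
    - by right; rewrite [X in sgen _ X]mul1_brauer.
    - by right; rewrite [X in sgen _ X]mulbrauer1.
    - by right; exact: sgen_subsemigroup.
  move=> b [Eb|Ob]; split.
  - exact: FXL_codef_le_def (EX_FXL Eb).
  - by move=> Gb; left; exact: EX_unit.
  - exact: FXL_codef_le_def (OF _ Ob).
  - by move=> Gb; right; exact: sgen_sub.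
(* The unit 1 is the square of an involution other than 1, so it is no
   exception. *)
have [F [FI F1]] := involutions.
have GF A : GX X (F A) by split; exists (F A); exact: F1.
have [A FA] : exists A, F A <> one_brauer X.
  apply: contrapT => n; have E A : F A = one_brauer X by apply: contrapT => nA; apply: n; exists A.
  have /FI : F set0 = F setT by rewrite !E.
  by move=> T0; apply: infX; rewrite -T0; exact: finite_set0.
move=> a /gen[->|//]; have [//|FG] := gen _ (GF A).
by rewrite -(F1 A); exact: sgen_subsemigroup.
Qed.

(** Adding a copy of [mu] to [X] does not change its size, so [X] has a copy of
    itself whose complement is equipotent to [mu]. *)
Lemma left_unit_defect mu : exists a, codefect_set a = set0 /\ defect_set a #= mu.
Proof.
have /card_eq_bij_rel[R [RP RT TR Rf Ri]] := csum_setT mu.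
have /choice[h hR] x : exists y, R (inl x) y by exact: RT.
have hI : injective h by move=> x y E; have := hR x; rewrite E => /Ri/(_ (hR y))[].
exists (inj_brauer hI); split; first exact: inj_codefect.
apply/card_eq_bij_rel; exists (fun x z => R (inr z) x); split.
- move=> x z Rzx; split; last by have [] := RP _ _ Rzx.
  by move=> [y /= E]; have := hR y; rewrite -E => /Ri/(_ Rzx).
- move=> x nx; have [[y|z] Rx] := TR x I; last by exists z.
  by case: nx; exists y => /=; exact: Rf Rx (hR y).
- by move=> z muz; exact: (RT (inr z)).
- by move=> x y z /Ri H /H[].
- by move=> x y z /Rf H /H.
Qed.

Lemma defect_indexP mu : defect_index X mu <-> indecomposable mu.
Proof. by rewrite /defect_index /indecomposable /= infiniteP. Qed.

(** Otherwise all generators would lie in the subsemigroup of the graphs without a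
    jump at [mu], which contains no left unit of defect [mu]. *)
Lemma jumps_generated Om mu : Om `<=` FXL X -> FXL X = sgen (EX X `|` Om) ->
  indecomposable mu -> exists2 a, Om a & defect_jump mu a.
Proof.
move=> OF FE imu; apply: contrapT => nO.
have [a [a0 amu]] := left_unit_defect mu.
have Fa : FXL X a by apply: sgen_sub; right; exact/left_unitP.
suff : codef_le_def a /\ ~ defect_jump mu a.
  case=> _; apply; split=> //; apply/card_ltP; rewrite a0; split; first exact: card_ge0.
  exact: indecomposable_neq0.
pose Q : set (brauer_graph X) := [set c | codef_le_def c /\ ~ defect_jump mu c].
have sQ : subsemigroup Q.
  move=> b c [lb nb] [lc nc]; split; first exact: codef_le_def_mul.
  by move=> /(defect_jump_mul imu lb lc)[].
rewrite FE in Fa; apply: (sgen_min (M := Q)) Fa => // b [Eb|Ob]; last first.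
  by split; [exact: FXL_codef_le_def (OF _ Ob)|move=> jb; apply: nO; exists b].
apply: (sgen_min (M := Q)) Eb => // e /defect_idem ee; split; first exact: card_eq_lel.
move=> [/card_ltP[_ nmu] de]; apply: nmu.
by apply: card_le_trans (card_eq_ler de) _; exact: card_eq_ler.
Qed.

Lemma setC_card mu nu : infinite_set mu -> ~ (mu #<= nu) -> ~` nu #= [set: X].
Proof.
move=> infm nmn; have : csum nu (~` nu) #= [set: X].
  rewrite -(setUv nu) card_eq_sym; exact: setU_csum.
case/csum_indecomposable => //; first by right.
by move=> nuT; case: nmn; apply: card_le_trans (card_leT _) (card_eq_ler nuT).
Qed.

Section Sufficiency.
Variables (M : set (brauer_graph X)) (alpha : set X -> brauer_graph X).
Hypotheses (sM : subsemigroup M) (EM : EX X `<=` M) (GM : GX X `<=` M).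
Hypothesis alphaM : forall mu, indecomposable mu -> M (alpha mu) /\ defect_jump mu (alpha mu).

Let left_unit_of mu := exists a, [/\ M a, codefect_set a = set0 & defect_set a #= mu].

(** A graph with a jump at 1 is a left unit of defect 1. *)
Let finite_left_unit n mu : mu #= `I_n -> left_unit_of mu.
Proof.
elim: n mu => [|n IH] mu.
  rewrite II0 card_eq0 => /eqP ->; exists (one_brauer X); split.
  - by apply: EM; apply: sgen_sub; exact: mul1_brauer.
  - by apply/seteqP; split=> // x; apply; exists x; exists x; left.
  - rewrite card_eq0; apply/eqP/seteqP; split=> // x; apply; exists x; exists x; left.
    by [].
move=> /eq_cardSP[x mux /IH[b [Mb b0 db]]].
have i1 : indecomposable [set x].
  left; have -> : [set: unit] = [set tt] by apply/seteqP; split=> -[].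
  exact: eq_card1.
have [Ma [/card_ltP[_ nc] da]] := alphaM i1.
have a0 : codefect_set (alpha [set x]) = set0.
  apply/seteqP; split=> // y cy; apply: nc.
  by apply: (@card_le_inj _ _ _ _ (fun _ => y)) => // u v -> ->.
have [ab0 dab] := mul_left_units a0 b0.
exists (mul_brauer (alpha [set x]) b); split=> //; first exact: sM Ma Mb.
apply: card_eq_trans dab _; apply: card_eq_trans (csum_eq da db) _.
apply: card_eq_trans (card_esym (setU_csum _)) _; first by move=> y -> [_]; apply.
by rewrite setDUK // => _ ->.
Qed.

(** A least counterexample [nu] is infinite, and the codefect of [alpha nu] is
    smaller, hence the defect of a left unit [k] in [M].  The complements of both
    sets have the size of [X], so a unit moves the defect set of [k] onto the
    codefect set of [alpha nu]. *)
Let every_left_unit mu : left_unit_of mu.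
Proof.
apply: contrapT => nmu.
have [|{}nu {}nnu numin] := @card_min _ [set nu | ~ left_unit_of nu]; first by exists mu.
have infn : infinite_set nu by move=> [n /finite_left_unit].
have [Ma [/card_ltP[cle ncle] da]] := alphaM (or_intror infn).
set a := alpha nu in Ma cle ncle da.
have [k [Mk k0 dk]] : left_unit_of (codefect_set a).
  by apply: contrapT => /numin.
have nk : ~ (nu #<= defect_set k) by rewrite (card_le_eqr dk).
have /card_eq_bij_rel[R RP] := card_esym dk.
have cE : ~` codefect_set a #= ~` defect_set k.
  by apply: card_eq_trans (setC_card infn ncle) _; apply: card_esym; exact: setC_card infn nk.
have [g [h [gh hg gR]]] := bij_rel_extend RP cE.
have gI := can_inj gh; have hI := can_inj hg.
pose k' := pull_brauer gI k.
have k'E : k' = mul_brauer (inj_brauer hI) k by rewrite (mul_inj_brauer gI hI k gh hg).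
have Mk' : M k' by rewrite k'E; apply: sM => //; apply: GM; exact: inj_unit gh.
have k'0 : codefect_set k' = set0.
  have hk0 := inj_codefect hI.
  by rewrite k'E; case: (mul_left_units hk0 k0).
have ak' : codefect_set a = defect_set k'.
  apply/seteqP; split=> x.
    move=> cx [y xy]; have /gR cgx := cx; case: RP => RP _ _ _ _.
    by have [_] := RP _ _ cgx; apply; exists y.
  move=> nx; have : ~ dom k (g x) by move=> [y gy]; apply: nx; exists y.
  case: RP => RP _ kR Rf _ /kR[x' Rx']; have [cx' _] := RP _ _ Rx'.
  by rewrite -(gI _ _ (Rf _ _ _ (gR _ cx') Rx')).
have [dak cak] := mul_aligned ak'.
apply: nnu; exists (mul_brauer a k'); split; first exact: sM Ma Mk'.
  by apply/eqP; rewrite -(@card_eq0 _ X) -k'0.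
exact: card_eq_trans dak da.
Qed.

(** Remove from the defect set of [a] a copy of its codefect set; what remains is
    the defect of a left unit in [M]. *)
Lemma codef_le_def_generated a : codef_le_def a -> M a.
Proof.
move=> /card_le_sub[C Cd Ca].
have [k [Mk k0 dk]] := every_left_unit (defect_set a `\` C).
have [|e [g [ee Gg <-]]] := @factor_codefect X a k k0.
  rewrite -{1}(setDUK Cd); apply: card_eq_trans (setU_csum _) _; first by move=> x Cx [].
  by apply: csum_eq; exact: card_esym.
apply: sM; first by apply: EM; exact: sgen_sub.
exact: sM (GM Gg) Mk.
Qed.

End Sufficiency.

(** A graph is a set of pairs of vertices, and there are only |X| such pairs. *)
Lemma card_brauer_graph : [set: brauer_graph X] #<= [set: set X].
Proof.
pose Y : Type := (X + X)%type.
have YX : [set: Y] #<= [set: X].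
  apply: card_le_trans (infinite_csum infX); by apply: subset_card_le => -[].
have YYX : [set: Y * Y] #<= [set: X].
  rewrite -setXTT; apply: card_le_trans (card_le_setX YX YX) _.
  exact: card_setX_infinite.
have [j jI _] := card_leT_fun YYX.
apply: (@card_le_inj _ _ _ _ (fun a => j @` [set p | a p.1 p.2])) => // a b _ _ E.
apply: brauer_ext => u v.
have H c : c u v <-> (j @` [set p | c p.1 p.2]) (j (u, v)).
  by split=> [cuv|[p cp /jI pE]]; [exists (u, v)|rewrite pE in cp].
by rewrite H E -H.
Qed.

Lemma card_GX : [set: set X] #<= GX X.
Proof.
have [F [FI F1]] := involutions.
apply: (@card_le_inj _ _ _ _ F) => [A _|A B _ _ /FI//].
by split; exists (F A); exact: F1.
Qed.

Lemma Cantor : ~ ([set: set X] #<= [set: X]).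
Proof.
move=> /card_leT_fun[f fI _]; pose D := [set x | exists2 A, f A = x & ~ A x].
have [DD|nD] := pselect (D (f D)); last by apply: (nD); exists D.
by have [A /fI AD nA] := DD; apply: nA; rewrite AD.
Qed.

(** The generators that are units generate the 2^|X| units.  They cannot be finite
    in number, for then there would be at most |X| products. *)
Lemma FXL_rank : relative_rank (FXL X) (EX X) [set: set X].
Proof.
split=> [|U UF FE].
  exists (FXL X); split; first by [].
    apply/seteqP; split; first by move=> a Fa; apply: sgen_sub; right.
    apply: sgen_min; first exact: sgen_subsemigroup.
    by move=> a [/EX_FXL|].
  apply: card_eq_le2; first exact: card_le_trans (card_leT _) card_brauer_graph.
  exact: card_le_trans card_GX (subset_card_le GX_FXL).
have GU := units_generated UF FE; have := card_GX; rewrite GU => XU.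
have [finU|infU] := pselect (finite_set U).
  case: Cantor; apply: card_le_trans XU _; apply: card_sgen => //.
  apply: card_le_trans (subset_card_le (@subIsetr _ _ _)) _.
  apply: card_le_trans (finite_set_countable finU) _; exact/infiniteP.
apply: card_le_trans XU _; apply: card_sgen => //.
exact: subset_card_le (@subIsetr _ _ _).
Qed.

Lemma defect_jump_eq mu nu : mu #= nu -> defect_jump mu = defect_jump nu.
Proof.
move=> mn; apply: funext => a; rewrite /defect_jump /card_lt (card_le_eqr mn) (card_le_eql mn).
by rewrite (card_eqr mn).
Qed.

Lemma FXL_generated Om : Om `<=` FXL X ->
  (FXL X = sgen (EX X `|` Om) <->
   GX X = sgen (GX X `&` Om) /\
   exists alpha : set X -> brauer_graph X,
     defect_family alpha /\ alpha @` defect_index X `<=` Om).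
Proof.
move=> OF; split=> [FE|[GE [alpha [[_ aP] aO]]]].
  split; first exact: units_generated OF FE.
  (* The choice depends on [mu] only through a predicate that equipotent sets
     share, so equipotent sets have the same image. *)
  pose alpha mu := xget (one_brauer X) [set a | Om a /\ defect_jump mu a].
  have aP mu : defect_index X mu -> Om (alpha mu) /\ defect_jump mu (alpha mu).
    move=> /defect_indexP/(jumps_generated OF FE)[a Oa ja].
    by apply: (@xgetPex _ _ [set a | Om a /\ defect_jump mu a]); exists a.
  exists alpha; split; last by move=> _ [mu /aP[Oa _] <-].
  split=> [mu nu /defect_jump_eq mn|mu /aP[]//].
  by rewrite /alpha mn.
apply/seteqP; split.
  move=> a /FXL_codef_le_def; apply: (@codef_le_def_generated _ alpha).
  - exact: sgen_subsemigroup.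
  - by move=> b Eb; apply: sgen_sub; left.
  - by rewrite {1}GE; apply: sgen_mono => b [_ Ob]; right.
  - move=> mu /defect_indexP imu; split; last exact: aP.
    by apply: sgen_sub; right; apply: aO; exists mu.
apply: sgen_min; first exact: sgen_subsemigroup.
by move=> a [/EX_FXL|/OF].
Qed.
End RelativeRank.

Theorem theorem7p7 (X : Type) (infX : infinite_set [set: X]) :
  relative_rank (FXL X) (EX X) [set: set X] /\
  (forall Omega : set (brauer_graph X), Omega `<=` FXL X ->
     (FXL X = sgen (EX X `|` Omega) <->
      GX X = sgen (GX X `&` Omega) /\
      exists alpha : set X -> brauer_graph X,
        defect_family alpha /\ alpha @` defect_index X `<=` Omega)).
Proof. by split; [exact: FXL_rank|exact: FXL_generated]. Qed.
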